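(* Let $\gamma$ be the geodesic with $\gamma(0)=1$ and $\dot\gamma(0)=z_0+x_0$, $z_0\in\mathfrak z$, $x_0\in\mathfrak v$, and let $J=J_{z_0}$. (1) If $J=0$ and $x_0=0$, there are no points conjugate to $\gamma(0)$ along $\gamma$. (2) If $J=0$ and $x_0\neq0$, then for $t\neq0$, $\gamma(t)$ is conjugate to $\gamma(0)$ along $\gamma$ if and only if $-12/t^2$ is an eigenvalue of the linear operator $A:\mathfrak z\to\mathfrak z$, $A(z)=[x_0,J_zx_0]$; in that case $\mathrm{mult}_{cp}(t)=\dim\ker(A+\tfrac{12}{t^2}I)\le\dim\mathfrak z$. (3) If $J\neq0$ and $x_0=0$, let $-\lambda_1^2,\dots,-\lambda_q^2$ ($\lambda_k>0$, pairwise distinct) be the distinct negative real eigenvalues of $J^2$. Then $\gamma(t)$ is conjugate to $\gamma(0)$ along $\gamma$ if and only if $t\in\bigcup_{k=1}^q\frac{2\pi}{\lambda_k}\mathbb Z^*$, and for $t=\frac{2\pi}{\lambda_k}n$ ($n\in\mathbb Z^*$) $$\mathrm{mult}_{cp}\Big(\tfrac{2\pi}{\lambda_k}n\Big)=\sum_{h:\ \frac{\lambda_k}{n}\mid\lambda_h}\dim\ker(J^2+\lambda_h^2I)\le\dim\mathfrak v.$$ (In particular, if $J^2$ has no negative eigenvalues there are no conjugate points.)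
   Context: Let $N$ be a connected, simply connected, 2-step nilpotent real Lie group with Lie algebra $\mathfrak n$ and center $\mathfrak z$. Let $\langle\,,\rangle$ be an inner product on $\mathfrak n$, meaning a nondegenerate symmetric bilinear form (possibly indefinite); the same symbol denotes the induced left-invariant pseudo-Riemannian metric on $N$, with Levi-Civita connection $\nabla$. Assume the restriction of $\langle\,,\rangle$ to $\mathfrak z$ is nondegenerate and put $\mathfrak v=\mathfrak z^\perp$, so $\mathfrak n=\mathfrak z\oplus\mathfrak v$ orthogonally. For $z\in\mathfrak z$ define $J_z:\mathfrak v\to\mathfrak v$ by $\langle J_zx,y\rangle=\langle z,[x,y]\rangle$ for all $y\in\mathfrak v$; $J_z$ is skew-adjoint. All tangent spaces of $N$ are identified with $\mathfrak n=T_1N$ via left translation; with this identification the geodesic $\gamma$ with $\gamma(0)=1$, $\dot\gamma(0)=z_0+x_0$ satisfies $\dot\gamma(t)=z_0+e^{tJ_{z_0}}x_0$. A Jacobi field along $\gamma$ is a vector field $Y$ along $\gamma$ with $\nabla_{\dot\gamma}\nabla_{\dot\gamma}Y+R(Y,\dot\gamma)\dot\gamma=0$, where $R(X,Y)=\nabla_X\nabla_Y-\nabla_Y\nabla_X-\nabla_{[X,Y]}$. For $t_0\neq0$, $\gamma(t_0)$ is conjugate to $\gamma(0)$ along $\gamma$ if there is a nontrivial Jacobi field $Y$ along $\gamma$ with $Y(0)=Y(t_0)=0$; its multiplicity $\mathrm{mult}_{cp}(t_0)$ is the dimension of the space of Jacobi fields vanishing at $0$ and $t_0$. $\mathbb Z^*=\mathbb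 Z\setminus\{0\}$; for real $a,b$, $a\mid b$ means $b$ is a nonzero integer multiple of $a$. *)

(* Defs.v *)
From HB Require Import structures.
From mathcomp Require Import all_boot all_order all_algebra.
From mathcomp Require Import all_classical all_reals all_analysis.
Set Implicit Arguments. Unset Strict Implicit. Unset Printing Implicit Defensive.
Import Order.TTheory GRing.Theory Num.Theory.
Import numFieldNormedType.Exports.
Local Open Scope ring_scope.

Section Defs.
Variables (R : realType) (n : nat).
Local Notation V := 'rV[R]_n.

(* the (possibly indefinite) inner product with Gram matrix G *)
Definition N2_ip (G : 'M[R]_n) (x y : V) : R := (x *m G *m y^T) ord0 ord0.

Definition N2_bilinear_br (br : V -> V -> V) : Prop :=
  (forall a x y w, br (a *: x + y) w = a *: br x w + br y w) /\
  (forall x y, br x y = - br y x).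

Definition N2_two_step (br : V -> V -> V) : Prop :=
  N2_bilinear_br br /\
  (forall x y w, br (br x y) w = 0) /\
  (exists x y, br x y != 0).

Definition N2_center (br : V -> V -> V) (z : V) : Prop := forall x, br z x = 0.

Definition N2_vpart (G : 'M[R]_n) (br : V -> V -> V) (x : V) : Prop :=
  forall z, N2_center br z -> N2_ip G z x = 0.

(* Levi-Civita connection on left-invariant fields (Koszul formula) *)
Definition N2_levi_civita (G : 'M[R]_n) (br : V -> V -> V) (nab : V -> V -> V) : Prop :=
  forall X Y W, 2 * N2_ip G (nab X Y) W =
     N2_ip G (br X Y) W - N2_ip G (br Y W) X + N2_ip G (br W X) Y.

Definition N2_J_map (G : 'M[R]_n) (br : V -> V -> V) (Jf : V -> V -> V) : Prop :=
  forall z x, N2_center br z -> N2_vpart G br x ->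
    N2_vpart G br (Jf z x) /\ forall y, N2_vpart G br y -> N2_ip G (Jf z x) y = N2_ip G z (br x y).

(* covariant derivative along a curve with velocity c (left-invariant frame) *)
Definition N2_Dcov (nab : V -> V -> V) (c Y : R -> V) : R -> V :=
  fun t => derive1 Y t + nab (c t) (Y t).

Definition N2_curv (nab br : V -> V -> V) (X Y Z : V) : V :=
  nab X (nab Y Z) - nab Y (nab X Z) - nab (br X Y) Z.

Definition N2_is_jacobi (nab br : V -> V -> V) (c Y : R -> V) : Prop :=
  (forall t, derivable Y t 1) /\ (forall t, derivable (N2_Dcov nab c Y) t 1) /\
  forall t, N2_Dcov nab c (N2_Dcov nab c Y) t + N2_curv nab br (Y t) (c t) (c t) = 0.

Definition N2_Jac0 (nab br : V -> V -> V) (c : R -> V) (t0 : R) (Y : R -> V) : Prop :=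
  N2_is_jacobi nab br c Y /\ Y 0 = 0 /\ Y t0 = 0.

Definition N2_conjugate_pt (nab br : V -> V -> V) (c : R -> V) (t0 : R) : Prop :=
  exists Y, N2_Jac0 nab br c t0 Y /\ Y <> (fun _ => 0).

(* S (a set of vectors, assumed a subspace) has dimension d *)
Definition N2_has_dimV (S : V -> Prop) (d : nat) : Prop :=
  exists f : 'I_d -> V, (forall i, S (f i)) /\
    (forall a : 'I_d -> R, \sum_i a i *: f i = 0 -> forall i, a i = 0) /\
    (forall x, S x -> exists a : 'I_d -> R, x = \sum_i a i *: f i).

(* S (a set of curves R -> V, assumed a linear space) has dimension d *)
Definition N2_has_dimF (S : (R -> V) -> Prop) (d : nat) : Prop :=
  exists f : 'I_d -> R -> V, (forall i, S (f i)) /\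
    (forall a : 'I_d -> R, (forall t, \sum_i a i *: f i t = 0) -> forall i, a i = 0) /\
    (forall Y, S Y -> exists a : 'I_d -> R, forall t, Y t = \sum_i a i *: f i t).

Definition N2_rdvd (a b : R) : Prop := exists m : int, m != 0 /\ b = m%:~R * a.

End Defs.

(* Main.v *)
(** A geodesic satisfying [J = 0] or [x0 = 0] has constant velocity [C = z0 + x0] in the
left-invariant frame.  Put [A = [x0, .]] and let [B] be defined by
[<B Y, W> = <[Y, W], C> + <[x0, W], Y>]; then the Jacobi equation along it reads
[(Y' + A Y)' = B (Y' + A Y)].

If [J = 0], then [A^2 = B^2 = 0], so the solutions vanishing at 0 are cubic polynomials in [t],
and the vanishing at [T] reduces to [z + T^2 / 12 [x0, J_z x0] = 0].

If [x0 = 0], then [A = 0] and [B] is [J] on v and 0 on the center.  A solution vanishing at 0 and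
[T] has a velocity [X] with [X' = B X] and [X 0 = X T].  A Wronskian argument shows that on such [X]
the operator [B^2] is semisimple with real eigenvalues, so that factoring the characteristic
polynomial of [B^2] into real linear and quadratic factors splits the solution into harmonics of
frequencies [h] with [T h] a nonzero multiple of 2 pi.

Vectors are rows, so the matrices of [A] and [B] act on the right. *)

Require Import Defs.
From HB Require Import structures.
From mathcomp Require Import all_boot all_order all_algebra.
From mathcomp Require Import all_classical all_reals all_analysis.
From mathcomp Require Import ring lra complex.
Import Order.TTheory GRing.Theory Num.Theory.
Import numFieldNormedType.Exports.
Local Open Scope ring_scope.
Set Implicit Arguments. Unset Strict Implicit. Unset Printing Implicit Defensive.

(** Both A and B come from linearising the geodesic equation c' = - nab_c c for left-trivialised
    velocities. Along a variation of geodesics with variation field Y, the velocity C changes by Y'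
    + [C, Y] = Y' + A Y, and B is the derivative of c -> - nab_c c at C. This is why the equation is
    of first order in Y' + A Y.

    The obstacle is the indefinite metric. J is skew-adjoint, but J^2 may have Jordan blocks or
    nonreal eigenvalues, so no splitting into eigenspaces is available at the start. Only the
    solutions that meet the boundary conditions are semisimple. This holds for every real matrix B:
    the Wronskian is formed with the auxiliary Euclidean product [dotv], and its positivity does
    what the given form cannot. *)

Lemma is_derive_ext (R : realType) (W : normedModType R) (f g : R -> W) (t : R) (a b : W) :
  is_derive t (1 : R) f a -> f =1 g -> a = b -> is_derive t (1 : R) g b.
Proof. by move=> df /funext <- <-. Qed.

(** * Linear differential systems *)

Section Calculus.
Variables (R : realType) (n : nat).
Local Notation V := 'rV[R]_n.
Implicit Types (X Y : R -> V) (A B : 'M[R]_n) (u v w : V).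

Definition dotv u v : R := \sum_i u 0 i * v 0 i.

Lemma dotvDl u v w : dotv (u + v) w = dotv u w + dotv v w.
Proof. by rewrite /dotv -big_split; apply: eq_bigr => i _; rewrite mxE mulrDl. Qed.

Lemma dotvC u v : dotv u v = dotv v u.
Proof. by apply: eq_bigr => i _; rewrite mulrC. Qed.

Lemma dotvZl a u v : dotv (a *: u) v = a * dotv u v.
Proof. by rewrite /dotv mulr_sumr; apply: eq_bigr => i _; rewrite mxE mulrA. Qed.

Lemma dotvv_ge0 u : 0 <= dotv u u.
Proof. by apply: sumr_ge0 => i _; rewrite -expr2 sqr_ge0. Qed.

Lemma dotvv_eq0 u : dotv u u = 0 -> u = 0.
Proof.
move=> u0; apply/rowP => i; rewrite mxE; apply/eqP.
have := @psumr_eq0P _ _ predT _ (fun j _ => sqr_ge0 (u 0 j)) u0 i isT.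
by move/eqP; rewrite sqrf_eq0.
Qed.

Lemma is_derive_mxP X (t : R) v :
  is_derive t (1 : R) X v <-> forall i, is_derive t (1 : R) (fun s => X s 0 i) (v 0 i).
Proof.
split=> [[dX <-] i|dX].
  have dXi := (derivable_mxP _ _ _).1 dX.
  by apply: DeriveDef => //; rewrite derive_mx// mxE.
have dX' : derivable X t (1 : R).
  by apply/derivable_mxP => i j; rewrite (ord1 i); apply: ex_derive.
apply: DeriveDef => //; rewrite derive_mx//; apply/rowP => i; rewrite mxE.
exact: derive_val.
Qed.

Lemma is_derive_mulmxr X (t : R) v A :
  is_derive t (1 : R) X v -> is_derive t (1 : R) (fun s => X s *m A) (v *m A).
Proof.
move=> /is_derive_mxP dX; apply/is_derive_mxP => i.
have D := is_derive_sum (fun j => is_deriveZ (A j i) (dX j)); apply: (is_derive_ext D).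
  by move=> s; rewrite fct_sumE mxE; apply: eq_bigr => j _; rewrite /= mulrC.
by rewrite mxE; apply: eq_bigr => j _; rewrite [_ *: _]mulrC.
Qed.

Lemma is_derive_scalel (f : R -> R) (t a : R) v :
  is_derive t (1 : R) f a -> is_derive t (1 : R) (fun s => f s *: v) (a *: v).
Proof.
move=> df; apply/is_derive_mxP => i.
by apply: (is_derive_ext (is_deriveZ (v 0 i) df)) => [s|]; rewrite mxE [LHS]mulrC.
Qed.

Lemma is_derive_dotv X Y (t : R) v w :
  is_derive t (1 : R) X v -> is_derive t (1 : R) Y w ->
  is_derive t (1 : R) (fun s => dotv (X s) (Y s)) (dotv v (Y t) + dotv (X t) w).
Proof.
move=> /is_derive_mxP dX /is_derive_mxP dY.
have D := is_derive_sum (fun j => is_deriveM (dX j) (dY j)); apply: (is_derive_ext D).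
  by move=> s; rewrite fct_sumE.
rewrite /dotv -big_split; apply: eq_bigr => i _ /=.
by rewrite addrC; congr (_ + _); rewrite [LHS]mulrC.
Qed.

Lemma is_derive_eq_fun X Y (dX : R -> V) (t0 : R) :
  (forall t, is_derive t (1 : R) X (dX t)) ->
  (forall t, is_derive t (1 : R) Y (dX t)) ->
  X t0 = Y t0 -> X = Y.
Proof.
move=> hX hY h0; apply/funext => t; apply/rowP => i.
apply/eqP; rewrite -subr_eq0; apply/eqP.
transitivity ((X t0 - Y t0) 0 i); last by rewrite h0 subrr mxE.
transitivity ((X t - Y t) 0 i); first by rewrite !mxE.
apply: (@is_derive_0_is_cst _ (fun t => (X t - Y t) 0 i)) => s.
have : is_derive s (1:R) (X - Y) (dX s - dX s) by exact: is_deriveB.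
by rewrite subrr => /is_derive_mxP /(_ i); rewrite mxE.
Qed.

Lemma is_derive0_cst X t0 :
  (forall t, is_derive t (1 : R) X 0) -> forall t, X t = X t0.
Proof.
move=> h t; have -> // : X = cst (X t0).
by apply: (@is_derive_eq_fun _ _ (cst 0) t0) => // s; exact: is_derive_cst.
Qed.

(** Entrywise, |u_i u_j| <= (u_i^2 + u_j^2) / 2 <= u.u. A crude constant is enough for a Gronwall
    estimate. *)
Lemma mulmx_dotv_le B u : `|dotv (u *m B) u| <= (\sum_i \sum_j `|B i j|) * dotv u u.
Proof.
have le_dot (i : 'I_n) : `|u 0 i| ^+ 2 <= dotv u u.
  rewrite /dotv (bigD1 i)//= -expr2 real_normK ?num_real// lerDl.
  by apply: sumr_ge0 => j _; rewrite -expr2 sqr_ge0.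
rewrite {1}/dotv; under eq_bigr => i _ do rewrite mxE mulr_suml.
rewrite exchange_big /= mulr_suml (le_trans (ler_norm_sum _ _ _))//.
apply: ler_sum => i _; rewrite mulr_suml (le_trans (ler_norm_sum _ _ _))//.
apply: ler_sum => j _; rewrite mulrAC mulrC !normrM ler_wpM2l ?normr_ge0//.
have := le_dot i; have := le_dot j; have := sqr_ge0 (`|u 0 i| - `|u 0 j|); lra.
Qed.

(** Takes the place of matrix exponentials: explicit solutions are written down and compared with a
    given one, and a solution that vanishes at one time vanishes at all times. *)
Lemma linear_ode_unique X B t0 :
  (forall t, is_derive t (1 : R) X (X t *m B)) -> X t0 = 0 -> forall t, X t = 0.
Proof.
move=> dX X0 t; apply: dotvv_eq0.
set K := 2 * \sum_i \sum_j `|B i j|.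
pose E s := dotv (X s) (X s).
have dE s : is_derive s (1 : R) E (dotv (X s *m B) (X s) *+ 2).
  apply: is_derive_eq; first by apply: is_derive_dotv.
  by rewrite [in X in _ + X]dotvC mulr2n.
have E0 : E t0 = 0 by rewrite /E X0 /dotv big1// => i _; rewrite mxE mul0r.
have bound s : `|dotv (X s *m B) (X s) *+ 2| <= K * E s.
  rewrite -mulr_natl normrM ger0_norm// /K -mulrA ler_wpM2l//.
  exact: mulmx_dotv_le.
(* Gronwall: E exp(-e K s) is monotone on the side of t0 where t lies, e being the sign of t - t0 *)
pose F e s := E s * expR (- (e * K) * s).
have dF e s : is_derive s (1 : R) (F e)
    ((dotv (X s *m B) (X s) *+ 2 - e * K * E s) * expR (- (e * K) * s)).
  have dl : is_derive s (1 : R) ( *%R (- (e * K))) (- (e * K)).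
    by apply: (is_derive_ext (is_deriveZ (- (e * K)) (is_derive_id s 1))) => //; rewrite [LHS]mulr1.
  apply: (is_derive_ext (is_deriveM (dE s) (is_derive1_comp (is_derive_expR _) dl))) => //.
  rewrite /= /GRing.scale /=; ring.
have mvt e a b : a < b -> exists2 s, a < s < b &
    F e b - F e a = (dotv (X s *m B) (X s) *+ 2 - e * K * E s) * expR (- (e * K) * s) * (b - a).
  move=> ab; have cF : {within `[a, b], continuous (F e)}%classic.
    apply: continuous_subspaceT => s.
    by apply/differentiable_continuous/derivable1_diffP; have [] := dF e s.
  by have [s sab eq] := MVT ab (fun s _ => dF e s) cF; exists s; rewrite ?in_itv// in sab *.
have Fge0 e s : 0 <= F e s by rewrite mulr_ge0 ?expR_ge0 ?dotvv_ge0.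
have F0 e : F e t0 = 0 by rewrite /F E0 mul0r.
have Ft0 e : F e t <= 0 -> E t = 0.
  move=> le0; have /eqP : F e t = 0 by apply/eqP; rewrite eq_le le0 Fge0.
  by rewrite mulf_eq0 (gt_eqF (expR_gt0 _)) orbF => /eqP.
case: (ltgtP t t0) => [lt|lt|-> //].
- apply: (Ft0 (-1)); have [s _] := mvt (-1) _ _ lt; rewrite F0.
  have : 0 <= (dotv (X s *m B) (X s) *+ 2 - -1 * K * E s) * expR (- (-1 * K) * s) * (t0 - t).
    rewrite !mulr_ge0 ?expR_ge0 ?subr_ge0 ?(ltW lt)//.
    by move: (bound s); rewrite ler_norml => /andP[]; lra.
  lra.
- apply: (Ft0 1); have [s _] := mvt 1 _ _ lt; rewrite F0.
  have : 0 <= (- (dotv (X s *m B) (X s) *+ 2 - 1 * K * E s)) * expR (- (1 * K) * s) * (t - t0).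
    rewrite !mulr_ge0 ?expR_ge0 ?subr_ge0 ?(ltW lt)//.
    by move: (bound s); rewrite ler_norml => /andP[]; lra.
  lra.
Qed.

End Calculus.

(** * Dimensions and sums of eigenspaces *)

Section Dimension.
Variable F : fieldType.

(** Stated over an arbitrary module so that vectors and curves are treated at once: [N2_has_dimV] is
    an instance by conversion, [N2_has_dimF] through the module of all functions. *)
Definition has_dim (U : lmodType F) (S : U -> Prop) (d : nat) : Prop :=
  exists f : 'I_d -> U, (forall i, S (f i)) /\
    (forall a : 'I_d -> F, \sum_i a i *: f i = 0 -> forall i, a i = 0) /\
    (forall x, S x -> exists a : 'I_d -> F, x = \sum_i a i *: f i).

Definition is_subspace (U : lmodType F) (S : U -> Prop) : Prop :=
  S 0 /\ forall a x y, S x -> S y -> S (a *: x + y).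

Lemma subspace_lincomb (U : lmodType F) (S : U -> Prop) d (f : 'I_d -> U) a :
  is_subspace S -> (forall i, S (f i)) -> S (\sum_i a i *: f i).
Proof.
move=> [S0 Slin] Sf; elim/big_rec: _ => // i x _ Sx; exact: Slin.
Qed.

Lemma has_dim_eq (U : lmodType F) (S S' : U -> Prop) d :
  (forall x, S x <-> S' x) -> has_dim S d -> has_dim S' d.
Proof.
move=> SS' [f [Sf [free span]]]; exists f; split; first by move=> i; apply/SS'.
by split=> // x /SS'; exact: span.
Qed.

(** If m < d, the d x m matrix expressing the free family in the spanning one has a nonzero left
    kernel vector, which is a linear relation in the free family. *)
Lemma has_dim_le (U : lmodType F) (S S' : U -> Prop) d m :
  (forall x, S x -> S' x) -> has_dim S d -> has_dim S' m -> (d <= m)%N.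
Proof.
move=> SS' [f [Sf [freef _]]] [g [_ [_ spang]]].
have /choice[p fp] : forall i, exists a : 'I_m -> F, f i = \sum_j a j *: g j.
  by move=> i; apply/spang/SS'.
pose P := \matrix_(i < d, j < m) p i j.
rewrite leqNgt; apply/negP => lt_md.
have : kermx P != 0.
  by rewrite -mxrank_eq0 mxrank_ker subn_eq0 -ltnNge (leq_ltn_trans (rank_leq_col P)).
case/rowV0Pn => u /sub_kermxP uP; case/eqP; apply/rowP => i; rewrite mxE.
apply: (freef (fun i => u 0 i)).
under eq_bigr => k _ do rewrite fp scaler_sumr.
rewrite exchange_big big1//= => j _.
under eq_bigr => k _ do rewrite scalerA.
rewrite -scaler_suml.
move/matrixP/(_ 0 j) : uP; rewrite !mxE => uPj.
by rewrite [X in X *: _](_ : _ = 0) ?scale0r// -[RHS]uPj; apply: eq_bigr => k _; rewrite mxE.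
Qed.

Lemma has_dim_image (U U' : lmodType F) (S : U -> Prop) (S' : U' -> Prop)
    (phi : U -> U') d :
  (forall a x y, phi (a *: x + y) = a *: phi x + phi y) ->
  (forall x, phi x = 0 -> x = 0) ->
  (forall y, S' y <-> exists2 x, S x & y = phi x) ->
  has_dim S d -> has_dim S' d.
Proof.
move=> lin inj im [f [Sf [freef spanf]]].
have phi0 : phi 0 = 0.
  by have /eqP := lin 1 0 0; rewrite !scale1r addr0 -subr_eq0 opprD addNKr oppr_eq0 => /eqP.
have phi_sum (a : 'I_d -> F) : phi (\sum_i a i *: f i) = \sum_i a i *: phi (f i).
  elim/big_rec2: _ => // i y x _ <-; exact: lin.
exists (phi \o f); split; first by move=> i; apply/im; exists (f i).
split=> [a|y /im[x Sx ->]]; first by rewrite /= -phi_sum => /inj; exact: freef.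
by have [a ->] := spanf x Sx; exists a; rewrite phi_sum.
Qed.

Lemma has_dim_sum (U : lmodType F) (S1 S2 : U -> Prop) d1 d2 :
  is_subspace S1 -> is_subspace S2 ->
  (forall u v, S1 u -> S2 v -> u + v = 0 -> u = 0) ->
  has_dim S1 d1 -> has_dim S2 d2 ->
  has_dim (fun x => exists u v, [/\ S1 u, S2 v & x = u + v]) (d1 + d2).
Proof.
move=> sub1 sub2 direct [f [Sf [freef spanf]]] [g [Sg [freeg spang]]].
pose h (i : 'I_(d1 + d2)) := match fintype.split i with inl j => f j | inr k => g k end.
have hl i : h (lshift d2 i) = f i.
  by rewrite /h; case: splitP => j /= ij; [congr f; apply: val_inj | move: (ltn_ord i); rewrite ij ltnNge leq_addr].
have hr i : h (rshift d1 i) = g i.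
  rewrite /h; case: splitP => j /= ij; first by move: (ltn_ord j); rewrite -ij ltnNge leq_addr.
  by congr g; apply/val_inj/eqP; rewrite -(eqn_add2l d1) ij.
have hsum (a : 'I_(d1 + d2) -> F) : \sum_i a i *: h i =
    \sum_i a (lshift d2 i) *: f i + \sum_i a (rshift d1 i) *: g i.
  by rewrite big_split_ord /=; congr (_ + _); apply: eq_bigr => i _; rewrite ?hl ?hr.
exists h; split; [|split].
- move=> i; rewrite -(fintype.splitK i); case: (fintype.split i) => j /=; rewrite ?hl ?hr.
    by exists (f j), 0; split; rewrite ?addr0//; case: sub2.
  by exists 0, (g j); split; rewrite ?add0r//; case: sub1.
- move=> a; rewrite hsum => eq0.
  have l0 := direct _ _ (subspace_lincomb _ sub1 Sf) (subspace_lincomb _ sub2 Sg) eq0.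
  move: eq0; rewrite l0 add0r => r0 i; rewrite -(fintype.splitK i); case: (fintype.split i) => j /=.
    exact: (freef (fun i => a (lshift d2 i))).
  exact: (freeg (fun i => a (rshift d1 i))).
- move=> _ [u [v [/spanf[a ->] /spang[b ->] ->]]].
  exists (fun i => match fintype.split i with inl j => a j | inr k => b k end).
  rewrite hsum; congr (_ + _); apply: eq_bigr => i _; congr (_ *: _).
    by case: splitP => j /= ij; [congr a; apply: val_inj | move: (ltn_ord i); rewrite ij ltnNge leq_addr].
  case: splitP => j /= ij; first by move: (ltn_ord j); rewrite -ij ltnNge leq_addr.
  by congr b; apply/val_inj/eqP; rewrite -(eqn_add2l d1) ij.
Qed.

(** The summands are predicates on a module that may be infinite-dimensional, such as the space of
    all curves. *)
Fixpoint sum_spaces (U : lmodType F) (I : Type) (S : I -> U -> Prop) (s : seq I) : U -> Prop :=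
  if s is i :: s' then
    fun x => exists u v, [/\ S i u, sum_spaces S s' v & x = u + v]
  else fun x => x = 0.

Lemma sum_spaces_subspace (U : lmodType F) (I : Type) (S : I -> U -> Prop) (s : seq I) :
  (forall i, is_subspace (S i)) -> is_subspace (sum_spaces S s).
Proof.
move=> subS; elim: s => [|i s [IH0 IHs]] /=; first by split=> // a x y -> ->; rewrite scaler0 addr0.
split; first by exists 0, 0; split; rewrite ?addr0//; case: (subS i).
move=> a _ _ [u [v [Su Sv ->]]] [u' [v' [Su' Sv' ->]]].
exists (a *: u + u'), (a *: v + v'); split; [by apply: (subS i).2|exact: IHs|].
by rewrite scalerDr addrACA.
Qed.

Lemma sum_spaces_mem (U : lmodType F) (I : eqType) (S : I -> U -> Prop) (s : seq I) i x :
  (forall i, is_subspace (S i)) -> i \in s -> S i x -> sum_spaces S s x.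
Proof.
move=> subS; elim: s => // j s IH; rewrite inE => /predU1P[<-|/IH{}IH] Sx /=.
  by exists x, 0; split; rewrite ?addr0//; case: (sum_spaces_subspace s subS).
by exists 0, x; split; rewrite ?add0r//; [case: (subS j)|apply: IH].
Qed.

Lemma sum_spaces_sub (U : lmodType F) (I : eqType) (S S' : I -> U -> Prop) (s : seq I) x :
  {in s, forall i x, S i x -> S' i x} -> sum_spaces S s x -> sum_spaces S' s x.
Proof.
elim: s x => // i s IH x SS' /= [u [v [Su Sv ->]]].
exists u, v; split=> //; first by apply: SS' => //; exact: mem_head.
by apply: IH => // j js; apply: SS'; rewrite inE js orbT.
Qed.

Lemma sum_spaces_le (U : lmodType F) (I : eqType) (S : I -> U -> Prop) (P : U -> Prop) (s : seq I) x :
  is_subspace P -> {in s, forall i x, S i x -> P x} -> sum_spaces S s x -> P x.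
Proof.
move=> [P0 Plin]; elim: s x => [x _ ->//|i s IH x SP /= [u [v [Su Sv ->]]]].
rewrite -[u]scale1r; apply: Plin; first by apply: (SP i) => //; exact: mem_head.
by apply: IH => // j js; apply: SP; rewrite inE js orbT.
Qed.

Section Eigen.
Variables (U : lmodType F) (f : U -> U).
Hypothesis lin_f : forall a x y, f (a *: x + y) = a *: f x + f y.

Let eigen (I : Type) (mu : I -> F) i x := f x = mu i *: x.

(** Applying f - mu i to the relation removes the component for i, multiplies u by the nonzero
    scalar b - mu i, and leaves the other components eigenvectors, so induction applies. *)
Lemma eigenvector_sum_eq0 (I : eqType) (mu : I -> F) (s : seq I) b u v :
  {in s, forall i, b != mu i} -> f u = b *: u -> sum_spaces (eigen mu) s v ->
  u + v = 0 -> u = 0.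
Proof.
have f0 : f 0 = 0.
  by have /eqP := lin_f 1 0 0; rewrite !scale1r addr0 -subr_eq0 opprD addNKr oppr_eq0 => /eqP.
have fZ a x : f (a *: x) = a *: f x by rewrite -[a *: x]addr0 lin_f f0 addr0.
have fD x y : f (x + y) = f x + f y by rewrite -[x]scale1r lin_f !scale1r.
have sub c i : is_subspace (eigen (fun i : I => c i) i).
  split; first by rewrite /eigen f0 scaler0.
  by move=> a x y fx fy; rewrite /eigen lin_f fx fy scalerDr !scalerA mulrC.
elim: s u v => [u v _ _ /= ->|i s IH u _ bs fu /= [w [v [fw Sv ->]]] uwv]; first by rewrite addr0.
have bi : b != mu i by apply: bs; rewrite mem_head.
have : (b - mu i) *: u = 0.
  apply: (IH _ (f v - mu i *: v)).
  - by move=> j js; apply: bs; rewrite inE js orbT.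
  - by rewrite fZ fu !scalerA mulrC.
  - have [S0 Slin] := sum_spaces_subspace s (sub mu).
    rewrite addrC -scaleNr; apply: Slin => //.
    elim: s v Sv {IH bs uwv S0} => [v /= ->|j s IH v /= [x [y [fx Sy ->]]]]; first by rewrite f0.
    rewrite /=; exists (f x), (f y); split; [by rewrite /eigen fx fZ fx|exact: IH|exact: fD].
  - have -> : (b - mu i) *: u + (f v - mu i *: v) = f (u + (w + v)) - mu i *: (u + (w + v)).
      rewrite !fD fu fw scalerBl !scalerDr !opprD [RHS]addrACA; congr (_ + _).
      by rewrite addrACA subrr add0r.
    by rewrite uwv f0 scaler0 subr0.
by move/eqP; rewrite scaler_eq0 subr_eq0 (negPf bi) /= => /eqP.
Qed.

Lemma has_dim_sum_spaces (I : eqType) (mu : I -> F) (S : I -> U -> Prop) (d : I -> nat) (s : seq I) :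
  uniq s -> {in s &, injective mu} ->
  (forall i, is_subspace (S i)) -> {in s, forall i x, S i x -> f x = mu i *: x} ->
  {in s, forall i, has_dim (S i) (d i)} ->
  has_dim (sum_spaces S s) (\sum_(i <- s) d i).
Proof.
move=> + + subS; elim: s => [_ _ _ _|i s IH /= /andP[i_s us] injmu Seig dimS].
  rewrite big_nil; exists (fun=> 0); split; first by case.
  by split=> [a _ []//|x ->]; exists (fun=> 0); rewrite big_ord0.
have si j : j \in s -> j \in i :: s by move=> js; rewrite inE js orbT.
rewrite big_cons; apply: has_dim_sum => //; first exact: sum_spaces_subspace.
- move=> u v Su Sv; apply: (@eigenvector_sum_eq0 _ mu s (mu i)).
  + move=> j js; apply: contraNneq i_s => /injmu -> //; first exact: mem_head.
    exact: si.
  + by apply: Seig => //; exact: mem_head.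
  + by apply: sum_spaces_sub Sv => j js x; apply: Seig; exact: si.
- by apply: dimS; exact: mem_head.
- apply: IH => //.
  + by move=> j k js ks; apply: injmu; exact: si.
  + by move=> j js; apply: Seig; exact: si.
  + by move=> j js; apply: dimS; exact: si.
Qed.

End Eigen.
End Dimension.

(** A pointwise linear combination of curves is a linear combination in the module of functions. *)
Lemma has_dimFP (R : realType) n (S : (R -> 'rV[R]_n) -> Prop) d :
  N2_has_dimF S d <-> has_dim (U := (R -> 'rV[R]_n : lmodType R)) S d.
Proof.
have E (f : 'I_d -> R -> 'rV[R]_n) (a : 'I_d -> R) t :
    (\sum_i a i *: (f i : (R -> 'rV[R]_n : lmodType R))) t = \sum_i a i *: f i t.
  by rewrite fct_sumE.
split=> -[f [Sf [freef spanf]]]; exists f; split=> //; split.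
- by move=> a a0; apply: freef => t; rewrite -E a0.
- by move=> Y /spanf[a Ya]; exists a; apply/funext => t; rewrite E.
- by move=> a a0; apply: freef; apply/funext => t; rewrite E.
- by move=> Y /spanf[a ->]; exists a => t; rewrite E.
Qed.

(** * Rolle's theorem and the solutions of cos x = 1 *)

Lemma exists_derive_eq0 (R : realType) (f df : R -> R) (T : R) :
  T != 0 -> (forall t, is_derive t (1 : R) f (df t)) -> f 0 = f T -> exists t, df t = 0.
Proof.
move=> T0 hdf f0T.
have cf (a b : R) : {within `[a, b], continuous f}%classic.
  apply: continuous_subspaceT => s.
  by apply/differentiable_continuous/derivable1_diffP; have [] := hdf s.
have mvt (a b : R) : a < b -> f a = f b -> exists t, df t = 0.
  move=> ab fab; have [s _ /esym/eqP] := MVT ab (fun s _ => hdf s) (cf a b).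
  rewrite fab subrr mulf_eq0 subr_eq0 (gt_eqF ab) orbF => /eqP ?; by exists s.
by case: (ltgtP T 0) => [lt|lt|T00]; [exact: mvt lt _|exact: mvt lt _|rewrite T00 eqxx in T0].
Qed.

(** Subtracting the integral part of x / (2 pi) leaves y in [0, 2 pi) with cos y = 1. Then sin (y /
    2) = 0, and the sine is positive on (0, pi), so y = 0. *)
Lemma cos_eq1 (R : realType) (x : R) : cos x = 1 -> exists k : int, x = 2 * pi * k%:~R.
Proof.
move=> cx.
have p0 : 0 < 2 * pi :> R by rewrite mulr_gt0 ?pi_gt0.
pose k := Num.floor (x / (2 * pi)); exists k.
pose y := x - 2 * pi * k%:~R.
have y0 : 0 <= y.
  by rewrite subr_ge0 mulrC -ler_pdivlMr// floor_le.
have y1 : y < 2 * pi.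
  by have := floorD1_gt (x / (2 * pi)); rewrite -/k ltr_pdivrMr// intrD mulrDl mul1r /y [_ * k%:~R]mulrC; lra.
have perN (m : nat) z : cos (z + 2 * pi * m%:R) = cos z :> R.
  by rewrite mulr_natr mulr_natl (periodicn (@cosD2pi R)).
have cy : cos y = 1.
  rewrite -cx /y; case: (k) => m; first by rewrite -[in RHS](subrK (2 * pi * m%:R) x) perN.
  by rewrite NegzE intrN mulrN opprK perN.
have sy : sin (y / 2) = 0.
  apply/eqP; rewrite -sqrf_eq0 sin2cos2; apply/eqP.
  by have := cos_mulr2n (y / 2); rewrite -(mulr_natr (y / 2)) divfK ?pnatr_eq0// cy; lra.
have [yp|] := ltP 0 y.
  by have : 0 < sin (y / 2) by [apply: sin_gt0_pi; lra]; rewrite sy ltxx.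
by move=> yle; apply/eqP; rewrite -subr_eq0 -/y eq_le yle y0.
Qed.

Lemma cos_2pi_int (R : realType) (k : int) : cos (2 * pi * k%:~R) = 1 :> R.
Proof.
have perN (m : nat) : cos (2 * pi * m%:R) = 1 :> R.
  by rewrite mulr_natr mulr_natl -[_ *+ m]add0r (periodicn (@cosD2pi R)) cos0.
by case: k => m; [exact: perN | rewrite NegzE intrN mulrN cosN perN].
Qed.

Lemma sin_2pi_int (R : realType) (k : int) : sin (2 * pi * k%:~R) = 0 :> R.
Proof. by apply: cos1sin0; rewrite cos_2pi_int normr1. Qed.

(** * Real factors of real polynomials *)

Section RealPolynomial.
Variable R : rcfType.
Local Notation C := (complex R).

(** Take a complex root b + i c. If c is nonzero, the remainder of p modulo (X - b)^2 + c^2 is a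
    real polynomial of degree at most one that vanishes at a nonreal number, hence zero. *)
Lemma real_poly_factor (p : {poly R}) : (1 < size p)%N ->
  exists b c : R, (c = 0 /\ ('X - b%:P) %| p) \/
    (c != 0 /\ (('X - b%:P) ^+ 2 + (c ^+ 2)%:P) %| p).
Proof.
move=> p1.
have /closed_rootP [[b c] /= rz] : size (map_poly (real_complex R) p) != 1%N.
  by rewrite size_map_poly neq_ltn p1 orbT.
exists b, c; have [c0|c0] := eqVneq c 0; [left|right]; split=> //.
  rewrite dvdp_XsubCl; move: rz; rewrite c0.
  by rewrite (_ : Complex b 0 = real_complex R b)// fmorph_root.
set f := _ + _.
have fmon : f \is monic.
  rewrite monicE lead_coefDl ?lead_coef_exp ?lead_coefXsubC ?expr1n//.
  by rewrite size_exp_XsubC (leq_ltn_trans (size_polyC_leq1 _)).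
have fsize : size f = 3%N.
  by rewrite size_polyDl size_exp_XsubC// (leq_ltn_trans (size_polyC_leq1 _)).
rewrite /dvdp; set r := p %% f.
have r2 : (size r <= 2)%N by rewrite -ltnS -fsize ltn_modp -size_poly_eq0 fsize.
(* The root is reduced to three facts: it is a root of p, it is a root of f, and it is not real. *)
have [z [rpz fz indep]] : exists z : C, [/\ (map_poly (real_complex R) p).[z] = 0,
    (z - b%:C%C) ^+ 2 + c%:C%C ^+ 2 = 0 &
    forall u v : R, u%:C%C * z + v%:C%C = 0 -> u = 0].
  exists (Complex b c); split; first exact/eqP.
  - by apply/eqP; rewrite eq_complex /=; apply/andP; split; apply/eqP; ring.
  - move=> u v /eqP; rewrite eq_complex /= => /andP[_].
    by rewrite mul0r !addr0 mulf_eq0 (negPf c0) orbF => /eqP.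
have rz0 : (map_poly (real_complex R) r).[z] = 0.
  move: rpz; rewrite {1}(divp_eq p f) rmorphD rmorphM hornerD hornerM.
  rewrite {2}/f rmorphD rmorphXn /= map_polyXsubC map_polyC hornerD horner_exp hornerXsubC hornerC.
  rewrite (_ : _ ^+ 2 + _ = 0) ?mulr0 ?add0r// -[RHS]fz; congr (_ + _).
  exact: (rmorphXn (real_complex R)).
have Er : r = (r`_1)%:P * 'X + (r`_0)%:P.
  apply/polyP => -[|[|i]]; rewrite coefD coefCM coefX coefC /= ?mulr0 ?mulr1 ?add0r ?addr0//.
  by rewrite nth_default// (leq_trans r2).
move: rz0; move: Er (r`_1) (r`_0) => -> u v.
rewrite rmorphD rmorphM /= map_polyX !map_polyC hornerD hornerM hornerX !hornerC => e.
have u0 := indep _ _ e; move: e; rewrite u0 !rmorph0 !mul0r !add0r.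
by move=> /eqP; rewrite fmorph_eq0 => /eqP ->.
Qed.

End RealPolynomial.

Lemma mul_horner_mx_eigen (F : fieldType) n (M : 'M[F]_n.+1) (u : 'rV_n.+1) a (q : {poly F}) :
  u *m M = a *: u -> u *m horner_mx M q = q.[a] *: u.
Proof.
move=> uM; elim/poly_ind: q => [|q c IH]; first by rewrite rmorph0 mulmx0 horner0 scale0r.
rewrite rmorphD rmorphM /= horner_mx_X horner_mx_C mulmxDr mul_mx_scalar.
by rewrite mulmxA IH -scalemxAl uM !hornerE scalerDl scalerA.
Qed.

(** * The boundary value problem [Y'' = B Y'], [Y 0 = Y T = 0] *)

Section BoundaryValue.
Variables (R : realType) (n : nat) (B : 'M[R]_n.+1).
Local Notation V := 'rV[R]_n.+1.
Local Notation M := (B *m B).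

(** For c = 0 this excludes Jordan blocks: a periodic solution killed by (M - b)^2 is killed by M -
    b. For nonzero c it excludes the nonreal eigenvalues b + i c and b - i c of M. *)
Lemma periodic_semisimple (X : R -> V) (T b c : R) : T != 0 ->
  (forall t, is_derive t (1 : R) X (X t *m B)) -> X 0 = X T ->
  (forall t, X t *m ((M - b%:M) *m (M - b%:M) + (c ^+ 2)%:M) = 0) ->
  (forall t, X t *m (M - b%:M) = 0) /\ (c != 0 -> forall t, X t = 0).
Proof.
move=> T0 dX X0T XN; set N := M - b%:M in XN *.
have BN : B *m N = N *m B.
  by rewrite mulmxBr mulmxBl mulmxA scalar_mxC.
pose g t := X t *m N.
have dg t : is_derive t (1 : R) g (g t *m B).
  by apply: (is_derive_ext (is_derive_mulmxr N (dX t))) => //; rewrite -mulmxA BN mulmxA.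
have XM t : X t *m M = g t + b *: X t.
  by rewrite /g mulmxBr mul_mx_scalar subrK.
have gM t : g t *m M = b *: g t - c ^+ 2 *: X t.
  have := XN t; rewrite mulmxDr mulmxA -/(g t) mul_mx_scalar mulmxBr mul_mx_scalar => /eqP.
  by rewrite addrAC subr_eq0 => /eqP <-; rewrite addrK.
(* the Wronskian X' . g - X . g' takes the same value at 0 and T, and has derivative |g|^2 + c^2 |X|^2 *)
have [s] : exists s, dotv (g s) (g s) + c ^+ 2 * dotv (X s) (X s) = 0.
  pose E t := dotv (X t *m B) (g t) - dotv (X t) (g t *m B).
  apply: (@exists_derive_eq0 _ E _ T) => //; last by rewrite /E /g X0T.
  move=> t.
  have d1 := is_derive_dotv (is_derive_mulmxr B (dX t)) (dg t).
  have d2 := is_derive_dotv (dX t) (is_derive_mulmxr B (dg t)).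
  apply: (is_derive_ext (is_deriveB d1 d2)) => //.
  rewrite -!(mulmxA _ B B) XM gM dotvDl dotvZl [dotv (X t) (_ - _)]dotvC dotvDl -scaleNr !dotvZl.
  rewrite (dotvC (g t) (X t)); ring.
have gs0 : 0 <= dotv (g s) (g s) := dotvv_ge0 _.
have Xs0 : 0 <= c ^+ 2 * dotv (X s) (X s) by rewrite mulr_ge0 ?sqr_ge0 ?dotvv_ge0.
move=> /eqP; rewrite paddr_eq0// => /andP[/eqP gs /eqP Xs]; split.
  (* Vanishing at the single time s spreads to all times, because g solves the same equation as
     X. *)
  exact: (linear_ode_unique dg (dotvv_eq0 gs)).
move=> c0; apply: (linear_ode_unique dX (t0 := s)); apply: dotvv_eq0.
by move/eqP: Xs; rewrite mulf_eq0 sqrf_eq0 (negPf c0) => /eqP.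
Qed.

Definition bvp (T : R) (Y : R -> V) : Prop :=
  (exists X : R -> V, (forall t, is_derive t (1 : R) Y (X t)) /\
     (forall t, is_derive t (1 : R) X (X t *m B))) /\ Y 0 = 0 /\ Y T = 0.

Lemma bvp_subspace T : is_subspace (U := (R -> V : lmodType R)) (bvp T).
Proof.
split.
  split=> //; exists (fun=> 0); split=> t; first exact: is_derive_cst.
  by rewrite mul0mx; exact: is_derive_cst.
move=> a Y Y' [[X [dY dX]] [Y0 YT]] [[X' [dY' dX']] [Y0' YT']]; split; last first.
  by split; [change (a *: Y 0 + Y' 0 = 0); rewrite Y0 Y0'|change (a *: Y T + Y' T = 0); rewrite YT YT'];
      rewrite scaler0 addr0.
exists (fun t => a *: X t + X' t); split=> t.
  exact: (is_deriveD (is_deriveZ a (dY t)) (dY' t)).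
rewrite mulmxDl -scalemxAl; exact: (is_deriveD (is_deriveZ a (dX t)) (dX' t)).
Qed.

Lemma bvp_mulmx T Y (N : 'M[R]_n.+1) : N *m B = B *m N -> bvp T Y -> bvp T (fun t => Y t *m N).
Proof.
move=> NB [[X [dY dX]] [Y0 YT]]; split; last by rewrite Y0 YT mul0mx.
exists (fun t => X t *m N); split=> t; first exact: is_derive_mulmxr.
by rewrite -mulmxA NB mulmxA; exact: is_derive_mulmxr.
Qed.

(** X - Y B is a first integral, and Y vanishes at both ends. *)
Lemma bvp_velocity_periodic (T : R) (Y X : R -> V) :
  (forall t, is_derive t (1 : R) Y (X t)) -> (forall t, is_derive t (1 : R) X (X t *m B)) ->
  Y 0 = 0 -> Y T = 0 -> X 0 = X T.
Proof.
move=> dY dX Y0 YT.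
have cst t : X t - Y t *m B = X 0 - Y 0 *m B.
  apply: (is_derive0_cst (X := fun t => X t - Y t *m B)) => s.
  by apply: (is_derive_ext (is_deriveB (dX s) (is_derive_mulmxr B (dY s)))); rewrite ?subrr.
by have := cst T; rewrite Y0 YT mul0mx !subr0.
Qed.

Lemma velocity_mulmx_eq0 (Y X : R -> V) (N : 'M[R]_n.+1) :
  (forall t, is_derive t (1 : R) Y (X t)) -> Y 0 = 0 ->
  (forall t, X t *m N = 0) -> forall t, Y t *m N = 0.
Proof.
move=> dY Y0 XN t; transitivity (Y 0 *m N); last by rewrite Y0 mul0mx.
apply: (is_derive0_cst (X := fun t => Y t *m N)) => s.
by rewrite -(XN s); exact: is_derive_mulmxr.
Qed.

Lemma mulmx_velocity_eq0 (Y X : R -> V) (N : 'M[R]_n.+1) :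
  (forall t, is_derive t (1 : R) Y (X t)) ->
  (forall t, Y t *m N = 0) -> forall t, X t *m N = 0.
Proof.
move=> dY YN t; have d1 := is_derive_mulmxr N (dY t).
have d2 : is_derive t (1 : R) (fun s => Y s *m N) 0.
  by apply: (is_derive_ext (is_derive_cst 0 t 1)) => // s; rewrite YN.
by have [_ <-] := d1; have [_ ->] := d2.
Qed.

Lemma bvp_semisimple (T : R) (Y : R -> V) (b c : R) : T != 0 -> bvp T Y ->
  (forall t, Y t *m ((M - b%:M) *m (M - b%:M) + (c ^+ 2)%:M) = 0) ->
  (forall t, Y t *m (M - b%:M) = 0) /\ (c != 0 -> forall t, Y t = 0).
Proof.
move=> T0 [[X [dY dX]] [Y0 YT]] YN.
have [XN Xc] := periodic_semisimple T0 dX (bvp_velocity_periodic dY dX Y0 YT)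
  (mulmx_velocity_eq0 dY YN).
split=> [t|c0 t]; first exact: (velocity_mulmx_eq0 dY Y0 XN).
rewrite -[Y t]mulmx1; apply: (velocity_mulmx_eq0 dY Y0 (N := 1%:M)) => s.
by rewrite mulmx1; exact: Xc.
Qed.

(** When x B^2 = - h^2 x, the velocity x exp(t B) equals cos(h t) x + (sin(h t) / h) x B; this is
    its integral from 0 to t. *)
Definition harmonic (h : R) (x : V) (t : R) : V :=
  (sin (h * t) / h) *: x + ((1 - cos (h * t)) / h ^+ 2) *: (x *m B).

Definition harmonic_velocity (h : R) (x : V) (t : R) : V :=
  cos (h * t) *: x + (sin (h * t) / h) *: (x *m B).

Lemma is_derive_trigM (h t : R) :
  is_derive t (1 : R) (fun s => sin (h * s)) (h * cos (h * t)) /\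
  is_derive t (1 : R) (fun s => cos (h * s)) (- (h * sin (h * t))).
Proof.
have dl : is_derive t (1 : R) ( *%R h) h.
  by apply: (is_derive_ext (is_deriveZ h (is_derive_id t 1))) => //; rewrite [LHS]mulr1.
split.
  by apply: (is_derive_ext (is_derive1_comp (is_derive_sin (h * t)) dl)) => //; rewrite mulrC.
by apply: (is_derive_ext (is_derive1_comp (is_derive_cos (h * t)) dl)) => //; rewrite mulrC mulrN.
Qed.

Lemma is_derive_harmonic h x t : h != 0 ->
  is_derive t (1 : R) (harmonic h x) (harmonic_velocity h x t).
Proof.
move=> h0; have [ds dc] := is_derive_trigM h t.
have d1 : is_derive t (1 : R) (fun s => sin (h * s) / h) (cos (h * t)).
  by apply: (is_derive_ext (is_deriveZ h^-1 ds)) => [s|]; rewrite [LHS]mulrC//; field.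
have d2 : is_derive t (1 : R) (fun s => (1 - cos (h * s)) / h ^+ 2) (sin (h * t) / h).
  have d1' := is_deriveB (is_derive_cst (1 : R) t (1 : R)) dc.
  by apply: (is_derive_ext (is_deriveZ (h ^- 2) d1')) => [s|]; rewrite [LHS]mulrC//; field.
exact: (is_deriveD (is_derive_scalel x d1) (is_derive_scalel (x *m B) d2)).
Qed.

Lemma is_derive_harmonic_velocity h x t : h != 0 -> x *m M = - h ^+ 2 *: x ->
  is_derive t (1 : R) (harmonic_velocity h x) (harmonic_velocity h x t *m B).
Proof.
move=> h0 xM; have [ds dc] := is_derive_trigM h t.
have d1 : is_derive t (1 : R) (fun s => sin (h * s) / h) (cos (h * t)).
  by apply: (is_derive_ext (is_deriveZ h^-1 ds)) => [s|]; rewrite [LHS]mulrC//; field.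
apply: (is_derive_ext (is_deriveD (is_derive_scalel x dc) (is_derive_scalel (x *m B) d1))) => //.
rewrite mulmxDl -!scalemxAl -(mulmxA x) xM scalerA addrC; congr (_ + _); congr (_ *: _).
by field.
Qed.

Lemma harmonic_unique h (Y X : R -> V) : h != 0 ->
  (forall t, is_derive t (1 : R) Y (X t)) -> (forall t, is_derive t (1 : R) X (X t *m B)) ->
  Y 0 = 0 -> X 0 *m M = - h ^+ 2 *: X 0 ->
  X = harmonic_velocity h (X 0) /\ Y = harmonic h (X 0).
Proof.
move=> h0 dY dX Y0 XM.
have EX : X = harmonic_velocity h (X 0).
  apply/funext => t; apply/eqP; rewrite -subr_eq0; apply/eqP.
  apply: (linear_ode_unique (X := fun t => X t - harmonic_velocity h (X 0) t) (B := B) (t0 := 0)).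
    move=> s; rewrite mulmxBl; exact: (is_deriveB (dX s) (is_derive_harmonic_velocity s h0 XM)).
  by rewrite /harmonic_velocity mulr0 cos0 sin0 mul0r scale0r addr0 scale1r subrr.
split=> //; apply: (is_derive_eq_fun (t0 := 0) dY) => [t|].
  by rewrite {2}EX; exact: is_derive_harmonic.
by rewrite Y0 /harmonic mulr0 cos0 sin0 subrr !mul0r !scale0r addr0.
Qed.

Definition resonant (T h : R) := exists2 k : int, k != 0 & T * h = 2 * pi * k%:~R.

Lemma harmonic_bvp T h x : h != 0 -> resonant T h -> x *m M = - h ^+ 2 *: x ->
  bvp T (harmonic h x).
Proof.
move=> h0 [k _ Th] xM; split.
  exists (harmonic_velocity h x); split=> t; first exact: is_derive_harmonic.
  exact: is_derive_harmonic_velocity.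
split; first by rewrite /harmonic mulr0 cos0 sin0 subrr !mul0r !scale0r addr0.
by rewrite /harmonic [h * T]mulrC Th cos_2pi_int sin_2pi_int subrr !mul0r !scale0r addr0.
Qed.

Lemma harmonic_mulmx h x t (N : 'M[R]_n.+1) : N *m B = B *m N ->
  harmonic h x t *m N = harmonic h (x *m N) t.
Proof. by move=> NB; rewrite /harmonic mulmxDl -!scalemxAl -!mulmxA NB. Qed.

Lemma harmonic_linear h a x y t : harmonic h (a *: x + y) t = a *: harmonic h x t + harmonic h y t.
Proof.
rewrite /harmonic mulmxDl -scalemxAl !scalerDr !scalerA addrACA.
by congr (_ + _ + (_ + _)); congr (_ *: _); ring.
Qed.

Lemma harmonic_eq0 h x : h != 0 -> (forall t, harmonic h x t = 0) -> x = 0.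
Proof.
move=> h0 H.
(* At h t = pi only the term in x B survives, so x B = 0; then h t = pi / 2 isolates x. *)
have := H (pi / h); rewrite /harmonic [h * _]mulrC divfK// sinpi cospi mul0r scale0r add0r => /eqP.
rewrite scaler_eq0 mulf_eq0 invr_eq0 sqrf_eq0 (negPf h0) orbF.
rewrite (_ : 1 - -1 == 0 = false) /=; last by rewrite opprK (_ : 1 + 1 = 2%:R)// pnatr_eq0.
move/eqP => xB.
have := H (pi / 2 / h); rewrite /harmonic [h * _]mulrC divfK// xB scaler0 addr0 sin_pihalf mul1r => /eqP.
by rewrite scaler_eq0 invr_eq0 (negPf h0) => /eqP.
Qed.

Definition harmonic_space (T h : R) (Y : R -> V) : Prop :=
  bvp T Y /\ forall t, Y t *m M = - h ^+ 2 *: Y t.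

Lemma harmonic_space_subspace T h : is_subspace (U := (R -> V : lmodType R)) (harmonic_space T h).
Proof.
have [b0 blin] := bvp_subspace T.
split; first by split=> // t; rewrite mul0mx scaler0.
move=> a Y Y' [bY YM] [bY' YM']; split; first exact: blin.
move=> t; change ((a *: Y t + Y' t) *m M = - h ^+ 2 *: (a *: Y t + Y' t)).
by rewrite mulmxDl -scalemxAl YM YM' scalerDr !scalerA mulrC.
Qed.

Lemma bvp_eigen T Y b : T != 0 -> bvp T Y -> (exists t, Y t != 0) ->
  (forall t, Y t *m (M - b%:M) = 0) ->
  exists h, [/\ 0 < h, b = - h ^+ 2 & resonant T h].
Proof.
move=> T0 [[X [dY dX]] [Y0 YT]] [t1 Yt1] YN.
have XN := mulmx_velocity_eq0 dY YN.
have XM t : X t *m M = b *: X t.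
  by have /eqP := XN t; rewrite mulmxBr mul_mx_scalar subr_eq0 => /eqP.
have X0T := bvp_velocity_periodic dY dX Y0 YT.
have Xnot0 : (forall t, X t = 0) -> False.
  move=> X0; case/eqP: Yt1; rewrite -[Y t1]mulmx1.
  by apply: (velocity_mulmx_eq0 dY Y0) => t; rewrite mulmx1 X0.
have [b_ge0|b_lt0] := leP 0 b; last first.
  pose h := Num.sqrt (- b).
  have h_gt0 : 0 < h by rewrite sqrtr_gt0 oppr_gt0.
  have hb : b = - h ^+ 2 by rewrite sqr_sqrtr ?opprK// oppr_ge0 ltW.
  exists h; split=> //.
  have h0 := gt_eqF h_gt0.
  have XM0 : X 0 *m M = - h ^+ 2 *: X 0 by rewrite XM hb.
  have [EX _] := harmonic_unique (negbT h0) dY dX Y0 XM0.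
  have e : (cos (h * T) - 1) *: X 0 + (sin (h * T) / h) *: (X 0 *m B) = 0.
    apply/eqP; rewrite scalerBl scale1r addrAC subr_eq0; apply/eqP.
    by rewrite [RHS]X0T [in RHS]EX.
  have : cos (h * T) = 1.
    apply/eqP; rewrite -subr_eq0; apply: contra_notT Xnot0 => cT t.
    have eB : (cos (h * T) - 1) *: (X 0 *m B) - (h * sin (h * T)) *: X 0 = 0.
      have := congr1 (mulmx^~ B) e; rewrite mul0mx mulmxDl -!scalemxAl -(mulmxA (X 0)) XM0 scalerA => eB.
      by rewrite -[RHS]eB -scaleNr; congr (_ + _ *: _); field; rewrite h0.
    (* Eliminating X 0 B between [e] and its image [eB] under B leaves a sum of two squares times X
       0. *)
    have : ((cos (h * T) - 1) ^+ 2 + sin (h * T) ^+ 2) *: X 0 = 0.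
      transitivity ((cos (h * T) - 1) *: ((cos (h * T) - 1) *: X 0 + (sin (h * T) / h) *: (X 0 *m B))
        - (sin (h * T) / h) *: ((cos (h * T) - 1) *: (X 0 *m B) - (h * sin (h * T)) *: X 0)); last first.
        by rewrite e eB !scaler0 subrr.
      by move: (X 0 *m B) => w; apply/rowP => i; rewrite !mxE; field; rewrite h0.
    move/eqP; rewrite scaler_eq0 paddr_eq0 ?sqr_ge0// sqrf_eq0 (negPf cT) /= => /eqP X00.
    exact: (linear_ode_unique dX X00).
  move=> /cos_eq1[k hT]; exists k; last by rewrite mulrC.
  by apply: contra_neq T0 => k0; apply/eqP; move/eqP: hT; rewrite k0 mulr0 mulf_eq0 h0.
exfalso.
(* For b >= 0 the derivative |X B|^2 + b |X|^2 of E vanishes somewhere. There X B = 0, so X is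
   constant and Y is t X 0, which vanishes at T only if X 0 = 0. *)
pose E t := dotv (X t) (X t *m B).
have [s] : exists s, dotv (X s *m B) (X s *m B) + b * dotv (X s) (X s) = 0.
  apply: (@exists_derive_eq0 _ E _ T) => //; last by rewrite /E X0T.
  move=> t; apply: (is_derive_ext (is_derive_dotv (dX t) (is_derive_mulmxr B (dX t)))) => //.
  by rewrite -(mulmxA (X t)) XM [dotv (X t) _]dotvC dotvZl.
have XB0 := dotvv_ge0 (X s *m B).
have Xs0 : 0 <= b * dotv (X s) (X s) by rewrite mulr_ge0 ?dotvv_ge0.
move=> /eqP; rewrite paddr_eq0// => /andP[/eqP /dotvv_eq0 XsB _].
have XBz : forall t, X t *m B = 0.
  by apply: (linear_ode_unique (B := B) _ XsB) => t; exact: is_derive_mulmxr.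
have Xcst t : X t = X 0 by apply: is_derive0_cst => u; rewrite -(XBz u).
have EY : Y = fun t => t *: X 0.
  apply: (is_derive_eq_fun (t0 := 0) dY) => [t|]; last by rewrite scale0r.
  rewrite Xcst; apply: (is_derive_ext (is_derive_scalel (X 0) (is_derive_id t 1))) => //.
  by rewrite scale1r.
apply: Xnot0 => t; rewrite Xcst; apply/eqP; move/eqP: YT.
by rewrite EY scaler_eq0 (negPf T0).
Qed.

Lemma horner_mx_comm (q : {poly R}) : horner_mx M q *m B = B *m horner_mx M q.
Proof.
elim/poly_ind: q => [|q c IH]; first by rewrite rmorph0 mul0mx mulmx0.
rewrite rmorphD rmorphM /= horner_mx_X horner_mx_C mulmxDl mulmxDr scalar_mxC; congr (_ + _).
by rewrite -[_ * _]/(_ *m _) !mulmxA IH.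
Qed.

Lemma bvp_decomposition T Y (s : seq R) : T != 0 ->
  (forall h, 0 < h -> resonant T h ->
     (exists2 x : V, x != 0 & x *m M = - h ^+ 2 *: x) -> h \in s) ->
  bvp T Y -> sum_spaces (U := (R -> V : lmodType R)) (harmonic_space T) s Y.
Proof.
move=> T0 hs.
suff H m (p : {poly R}) Z : (size p <= m)%N -> p != 0 -> bvp T Z ->
    (forall t, Z t *m horner_mx M p = 0) ->
    sum_spaces (U := (R -> V : lmodType R)) (harmonic_space T) s Z.
  move=> bY; apply: (H _ (char_poly M) Y (leqnn _)) => //.
    by rewrite monic_neq0// char_poly_monic.
  by move=> t; rewrite Cayley_Hamilton mulmx0.
have [S0 Slin] := sum_spaces_subspace s (harmonic_space_subspace T).
elim: m p Z => [p Z|m IH p Z sp p0 bZ Zp].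
  by rewrite leqn0 size_poly_eq0 => /eqP ->; rewrite eqxx.
have [p1|p1] := leqP (size p) 1.
  have Z0 : Z = 0.
    apply/funext => t; have := Zp t; rewrite (size1_polyC p1) horner_mx_C mul_mx_scalar => /eqP.
    rewrite scaler_eq0 => /orP[/eqP c0|/eqP //]; move: p0.
    by rewrite (size1_polyC p1) c0 polyC0 eqxx.
  by rewrite Z0.
have [b [c]] := real_poly_factor p1.
have size_q (f q : {poly R}) : (1 < size f)%N -> p = q * f -> (size q <= m)%N /\ q != 0.
  move=> f1 pq; have q0 : q != 0 by apply: contra_neq p0 => q0; rewrite pq q0 mul0r.
  have f0 : f != 0 by rewrite -size_poly_gt0 ltnW.
  split=> //; rewrite -ltnS (leq_trans _ sp)// pq size_mul//.
  by move: f1; case: (size f) => [|[|k]]// _; rewrite !addnS ltnS leq_addr.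
have XbE : horner_mx M ('X - b%:P) = M - b%:M.
  by rewrite rmorphB /= horner_mx_X horner_mx_C.
case=> -[c0 /dvdpP[q pq]].
- have [sq q0] : (size q <= m)%N /\ q != 0 by apply: (size_q _ _ _ pq); rewrite size_XsubC.
  pose W t := Z t *m horner_mx M q.
  have bW : bvp T W := bvp_mulmx (horner_mx_comm q) bZ.
  have WN t : W t *m (M - b%:M) = 0.
    by rewrite -XbE -mulmxA -[_ *m horner_mx M _]rmorphM /= -pq.
  have WM t : W t *m M = b *: W t.
    by have /eqP := WN t; rewrite mulmxBr mul_mx_scalar subr_eq0 => /eqP.
  have [[t Wt]|W0] := pselect (exists t, W t != 0); last first.
    refine (IH _ _ sq q0 bZ _) => t; apply/eqP; rewrite -[_ *m _]/(W t).
    by apply: contraT => Wt; case: W0; exists t.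
  have [h [h_gt0 bh res]] := bvp_eigen T0 bW (ex_intro _ t Wt) WN.
  have h_s : h \in s.
    by apply: hs => //; exists (W t) => //; rewrite WM bh.
  (* If b is a repeated root, write q = r (X - b): the solution Z r(M) is killed by (M - b)^2, hence
     by M - b, so q already annihilates Z. *)
  have [qb|qb] := eqVneq q.[b] 0.
    refine (IH _ _ sq q0 bZ _).
    have /factor_theorem[r qr] : root q b by apply/eqP.
    have bP := bvp_mulmx (horner_mx_comm r) bZ.
    have PN2 u : Z u *m horner_mx M r *m ((M - b%:M) *m (M - b%:M) + (0 ^+ 2)%:M) = 0.
      rewrite expr0n /= raddf0 addr0 mulmxA -(mulmxA (Z u)).
      by rewrite -XbE -[horner_mx M r *m _]rmorphM /= -qr XbE; exact: WN.
    have [PN _] := bvp_semisimple T0 bP PN2.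
    by move=> u; rewrite qr rmorphM /= XbE -[_ * _]/(_ *m _) mulmxA.
  have W_in : sum_spaces (U := (R -> V : lmodType R)) (harmonic_space T) s W.
    apply: (sum_spaces_mem (harmonic_space_subspace T) h_s).
    by split=> // u; rewrite WM bh.
  (* On W = Z q(M) the matrix q(M) acts as the scalar q(b), so q annihilates Z - W / q(b). *)
  have -> : Z = q.[b]^-1 *: (W : (R -> V : lmodType R)) + (- q.[b]^-1 *: (W : (R -> V : lmodType R)) + Z).
    by rewrite addrA -scalerDl subrr scale0r add0r.
  apply: Slin => //.
  refine (IH _ _ sq q0 _ _); first by apply: (bvp_subspace T).2.
  move=> u; change ((- q.[b]^-1 *: W u + Z u) *m horner_mx M q = 0).
  by rewrite mulmxDl -scalemxAl (mul_horner_mx_eigen _ (WM u)) scalerA mulNr mulVf// scaleN1r addNr.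
- set f := _ + _ in pq.
  have f1 : (1 < size f)%N.
    by rewrite size_polyDl size_exp_XsubC// (leq_ltn_trans (size_polyC_leq1 _)).
  have [sq q0] := size_q _ _ f1 pq.
  (* Z q(M) is killed by a factor without real roots, so it is zero and q annihilates Z. *)
  refine (IH _ _ sq q0 bZ _).
  have bW := bvp_mulmx (horner_mx_comm q) bZ.
  have WN t : Z t *m horner_mx M q *m ((M - b%:M) *m (M - b%:M) + (c ^+ 2)%:M) = 0.
    have fE : horner_mx M f = (M - b%:M) *m (M - b%:M) + (c ^+ 2)%:M.
      by rewrite rmorphD rmorphXn /= XbE horner_mx_C expr2.
    by rewrite -fE -mulmxA -[_ *m horner_mx M _]rmorphM /= -pq.
  by have [_] := bvp_semisimple T0 bW WN; apply.
Qed.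

End BoundaryValue.

Lemma linear_mulmxE (F : fieldType) n m (f : 'rV[F]_n -> 'rV[F]_m) :
  (forall a x y, f (a *: x + y) = a *: f x + f y) -> exists A : 'M[F]_(n, m), forall x, f x = x *m A.
Proof.
move=> lin.
have f0 : f 0 = 0.
  by have /eqP := lin 1 0 0; rewrite !scale1r addr0 -subr_eq0 opprD addNKr oppr_eq0 => /eqP.
exists (\matrix_(i, j) f (delta_mx 0 i) 0 j) => x.
rewrite mulmx_sum_row {1}(row_sum_delta x).
have -> : f (\sum_j x 0 j *: delta_mx 0 j) = \sum_j x 0 j *: f (delta_mx 0 j).
  by elim/big_rec2: _ => // i y z _ <-; exact: lin.
by apply: eq_bigr => i _; congr (_ *: _); apply/rowP => j; rewrite !mxE.
Qed.

(** * Reduction of the Jacobi equation *)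

Section Nilpotent.
Variables (R : realType) (n : nat) (G : 'M[R]_n).
Local Notation V := 'rV[R]_n.
Variables (br nab Jf : V -> V -> V).
Hypotheses (Gsym : G^T = G) (Gunit : G \in unitmx) (br_two_step : N2_two_step br).
Hypothesis center_nondeg :
  forall z, N2_center br z -> (forall w, N2_center br w -> N2_ip G z w = 0) -> z = 0.
Hypotheses (nab_LC : N2_levi_civita G br nab) (Jf_J : N2_J_map G br Jf).
Local Notation ip := (N2_ip G).
Local Notation center := (N2_center br).
Local Notation vpart := (N2_vpart G br).
Implicit Types (u v w x y z : V) (A B : 'M[R]_n).

Lemma ipE x y : ip x y = dotv (x *m G) y.
Proof. by rewrite /N2_ip mxE; apply: eq_bigr => i _; rewrite [y^T _ _]mxE. Qed.

Lemma ipDl x y w : ip (x + y) w = ip x w + ip y w.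
Proof. by rewrite !ipE mulmxDl dotvDl. Qed.

Lemma ipZl a x w : ip (a *: x) w = a * ip x w.
Proof. by rewrite !ipE -scalemxAl dotvZl. Qed.

Lemma ipC x y : ip x y = ip y x.
Proof.
have -> : ip x y = (x *m G *m y^T)^T 0 0 by rewrite mxE.
by rewrite !trmx_mul trmxK Gsym mulmxA.
Qed.

Lemma ipNl x w : ip (- x) w = - ip x w.
Proof. by rewrite -scaleN1r ipZl mulN1r. Qed.

Lemma ipBl x y w : ip (x - y) w = ip x w - ip y w.
Proof. by rewrite ipDl ipNl. Qed.

Lemma ipDr x y w : ip w (x + y) = ip w x + ip w y.
Proof. by rewrite !(ipC w) ipDl. Qed.

Lemma ip0l w : ip 0 w = 0.
Proof. by rewrite -(scale0r 0) ipZl mul0r. Qed.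

Lemma ip0r w : ip w 0 = 0.
Proof. by rewrite ipC ip0l. Qed.

Lemma ip_nondeg x : (forall w, ip x w = 0) -> x = 0.
Proof.
move=> x0; have : x *m G = 0.
  apply/rowP => i; rewrite [RHS]mxE -(x0 (delta_mx 0 i)) ipE /dotv (bigD1 i)//= [delta_mx _ _ _ _]mxE !eqxx mulr1.
  by rewrite big1 ?addr0// => j ji; rewrite [delta_mx _ _ _ _]mxE (negPf ji) andbF mulr0.
by move/(congr1 (mulmx^~ (invmx G))); rewrite mulmxK// mul0mx.
Qed.

Lemma ip_eq x y : (forall w, ip x w = ip y w) -> x = y.
Proof.
move=> xy; apply/eqP; rewrite -subr_eq0; apply/eqP; apply: ip_nondeg => w.
by rewrite ipBl xy subrr.
Qed.

Lemma br_linl a x y w : br (a *: x + y) w = a *: br x w + br y w.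
Proof. by have [[+ _] _] := br_two_step; apply. Qed.

Lemma br_anti x y : br x y = - br y x.
Proof. by have [[_ +] _] := br_two_step; apply. Qed.

Lemma br_linr a x y w : br w (a *: x + y) = a *: br w x + br w y.
Proof. by rewrite !(br_anti w) br_linl opprD scalerN. Qed.

Lemma br0l w : br 0 w = 0.
Proof.
by have /eqP := br_linl 1 0 0 w; rewrite !scale1r addr0 -subr_eq0 opprD addNKr oppr_eq0 => /eqP.
Qed.

Lemma brDl x y w : br (x + y) w = br x w + br y w.
Proof. by rewrite -[x]scale1r br_linl !scale1r. Qed.

Lemma br_self x : br x x = 0.
Proof.
by have /eqP := br_anti x x; rewrite -addr_eq0 -mulr2n -scaler_nat scaler_eq0 pnatr_eq0 => /eqP.
Qed.

Lemma br_center x y : center (br x y).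
Proof. by have [_ [+ _]] := br_two_step; move=> + w; apply. Qed.

Lemma center_br x z : center z -> br x z = 0.
Proof. by move=> cz; rewrite br_anti cz oppr0. Qed.

Lemma vpart_subspace : is_subspace vpart.
Proof.
split=> [w _|a x y vx vy w cw]; first exact: ip0r.
by rewrite ipC ipDl ipZl !(ipC _ w) vx// vy// mulr0 addr0.
Qed.

Lemma vpart_center x z : vpart x -> center z -> ip x z = 0.
Proof. by move=> vx cz; rewrite ipC vx. Qed.

(** Let the rows of K form a basis of the center. Nondegeneracy on the center makes the Gram matrix
    K G K^T invertible, and x G K^T (K G K^T)^-1 K is the orthogonal projection of x to the
    center. *)
Lemma center_vpart_decomposition x : exists2 z, center z & vpart (x - z).
Proof.
(* [f z] lists the brackets of z with all basis vectors, so centrality becomes one linear equation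
   and the center a matrix kernel. *)
pose f z := mxvec (\matrix_(j < n) br z (delta_mx 0 j)).
have lin a y z : f (a *: y + z) = a *: f y + f z.
  rewrite /f -linearP /=; congr mxvec; apply/row_matrixP => j.
  by rewrite rowK linearP /= !rowK br_linl.
have [A AE] := linear_mulmxE lin.
have centerE z : center z <-> z *m A = 0.
  rewrite -AE /f; split=> [cz|z0 w].
    rewrite (_ : \matrix_(j < n) _ = 0) ?linear0//.
    by apply/row_matrixP => j; rewrite rowK cz row0.
  have bz j : br z (delta_mx 0 j) = 0.
    by rewrite -(rowK (fun j => br z (delta_mx 0 j)) j) -[\matrix_(i < n) _]mxvecK z0 linear0 row0.
  rewrite (row_sum_delta w); elim/big_rec: _ => [|j y _ IH]; first by rewrite br_anti br0l oppr0.
  by rewrite br_linr bz scaler0 add0r.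
pose K := row_base (kermx A).
have Kcenter (y : 'rV_(\rank (kermx A))) : center (y *m K).
  by apply/centerE/sub_kermxP; rewrite (submx_trans (submxMl _ _))// eq_row_base.
have centerK z : center z -> exists y : 'rV_(\rank (kermx A)), z = y *m K.
  by move=> /centerE /sub_kermxP; rewrite -(eq_row_base (kermx A)) => /submxP.
have ip_mul (u : 'rV_n) (y : 'rV_(\rank (kermx A))) : ip u (y *m K) = (u *m G *m K^T *m y^T) 0 0.
  by rewrite /N2_ip trmx_mul !mulmxA.
have Q_unit : K *m G *m K^T \in unitmx.
  rewrite -row_free_unit -kermx_eq0; apply/rowV0P => u /sub_kermxP uQ.
  have : u *m K = 0.
    apply: center_nondeg => // w /centerK[y ->].
    by rewrite ip_mul -(mulmxA u K G) -(mulmxA u (K *m G)) uQ mul0mx mxE.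
  by move/eqP; rewrite mulmx_free_eq0 ?row_base_free// => /eqP.
exists (x *m G *m K^T *m invmx (K *m G *m K^T) *m K) => // w /centerK[y ->].
by rewrite ipC ip_mul !mulmxBl -!(mulmxA _ K G) -(mulmxA _ (K *m G)) mulmxKV// subrr mxE.
Qed.

(** The identity defining J extends from v to every w: a central component of w is orthogonal to J_z
    x and commutes with x. *)
Lemma ip_Jf z x w : center z -> vpart x -> ip (Jf z x) w = ip z (br x w).
Proof.
move=> cz vx; have [vJ JE] := Jf_J cz vx.
have [w1 cw1 vw2] := center_vpart_decomposition w.
rewrite -(subrK w1 w) ipDr JE// (vpart_center vJ cw1) addr0.
by rewrite -[X in br x (X + w1)]scale1r br_linr (center_br x cw1) addr0 scale1r.
Qed.

Lemma nab_linr a x y w : nab w (a *: x + y) = a *: nab w x + nab w y.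
Proof.
apply: ip_eq => v; apply: (mulfI (x := 2)); first by rewrite pnatr_eq0.
rewrite nab_LC ipDl ipZl mulrDr [2 * (a * _)]mulrCA !nab_LC.
rewrite br_linr br_linl !ipDl !ipZl [ip (br v w) _]ipC ipDl ipZl !(ipC _ (br v w)); ring.
Qed.

Lemma nab_torsion x y : nab x y = nab y x + br x y.
Proof.
apply: ip_eq => v; apply: (mulfI (x := 2)); first by rewrite pnatr_eq0.
rewrite ipDl mulrDr !nab_LC [br v y]br_anti [br v x]br_anti [br y x]br_anti !ipNl; ring.
Qed.

Lemma ip_nab_self x w : ip (nab x x) w = ip (br w x) x.
Proof.
apply: (mulfI (x := 2)); first by rewrite pnatr_eq0.
rewrite nab_LC br_self ip0l [br x w]br_anti ipNl; ring.
Qed.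

Lemma is_derive_ip (c : R -> V) t u w : is_derive t (1 : R) c u ->
  is_derive t (1 : R) (fun s => ip (c s) w) (ip u w).
Proof.
move=> dc; apply: (is_derive_ext (is_derive_dotv (is_derive_mulmxr G dc) (is_derive_cst w t (1 : R)))).
  by move=> s; rewrite ipE.
by rewrite ipE [dotv _ 0]dotvC /dotv [X in _ + X]big1 ?addr0// => i _; rewrite mxE mul0r.
Qed.

Section Geodesic.
Variables (z0 x0 : V).
Hypotheses (z0_center : center z0) (x0_vpart : vpart x0).

Lemma ip_br_z0 : (forall x, vpart x -> Jf z0 x = 0) -> forall x w, ip (br x w) z0 = 0.
Proof.
move=> J0 x w; have [x1 cx1 vx2] := center_vpart_decomposition x.
by rewrite ipC -(subrK x1 x) brDl cx1 addr0 -ip_Jf// J0// ip0l.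
Qed.

(** Since <nab_x x, w> = <[w, x], x>, pairings of c with the center are conserved. Hence c - z0
    stays in v and solves x' = J x; it is constant if J = 0, and zero if it starts at zero. *)
Lemma constant_geodesic (c : R -> V) :
  (forall t, derivable c t 1) -> (forall t, derive1 c t + nab (c t) (c t) = 0) ->
  c 0 = z0 + x0 -> (forall x, vpart x -> Jf z0 x = 0) \/ x0 = 0 ->
  c = (fun=> z0 + x0) /\ nab (z0 + x0) (z0 + x0) = 0.
Proof.
move=> dc geo c0 hyp.
have dc' t : is_derive t (1 : R) c (- nab (c t) (c t)).
  have := derivableP (dc t); rewrite -derive1E => d.
  by apply: (is_derive_ext d) => //; apply/eqP; rewrite -addr_eq0 geo.
have cv t : vpart (c t - z0).
  move=> w cw; rewrite ipC ipBl.
  have -> : ip (c t) w = ip (c 0) w.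
    apply: (@is_derive_0_is_cst _ (fun s => ip (c s) w)) => s.
    apply: (is_derive_ext (is_derive_ip w (dc' s))) => //.
    by rewrite ipNl ip_nab_self cw ip0l oppr0.
  by rewrite c0 ipDl addrAC subrr add0r vpart_center.
(* The operator - 2 nab_{z0} is J on v: by Koszul's formula, - 2 <nab_{z0} x, w> = <[x, w], z0>. *)
have lin a x y : (- 2) *: nab z0 (a *: x + y) = a *: ((- 2) *: nab z0 x) + (- 2) *: nab z0 y.
  by rewrite nab_linr scalerDr !scalerA mulrC.
have [B BE] := linear_mulmxE lin.
have ipB x w : ip (x *m B) w = ip (br x w) z0.
  by rewrite -BE ipZl mulNr nab_LC z0_center ip0l [br w z0]center_br// ip0l; ring.
have dx t : is_derive t (1 : R) (fun s => c s - z0) ((c t - z0) *m B).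
  apply: (is_derive_ext (is_deriveB (dc' t) (is_derive_cst z0 t (1 : R)))) => //.
  rewrite subr0; apply: ip_eq => w; rewrite ipNl ip_nab_self ipB -ipNl -br_anti.
  rewrite -{2}(subrK z0 (c t)) ipDr (cv t _ (br_center _ _)) add0r.
  by rewrite -{1}(subrK z0 (c t)) [in LHS]brDl z0_center addr0.
have cE : c = fun=> z0 + x0.
  case: hyp => [J0|x00]; apply/funext => t.
    have e : c t - z0 = c 0 - z0.
      apply: (is_derive0_cst (X := fun s => c s - z0)) => s.
      apply: (is_derive_ext (dx s)) => //; apply: ip_nondeg => w.
      by rewrite ipB ip_br_z0.
    by rewrite -c0 -(subrK z0 (c t)) e subrK.
  rewrite x00 addr0; apply/eqP; rewrite -subr_eq0; apply/eqP.
  apply: (linear_ode_unique (t0 := 0) dx).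
  by rewrite c0 x00 addr0 subrr.
split=> //; have := geo 0; rewrite c0 cE => e.
by rewrite -[RHS]e -[LHS]add0r; congr (_ + _); rewrite derive1_cst.
Qed.

(** With L = nab_C, vanishing torsion makes A - 2 L the derivative of x -> - nab_x x at C. The
    curvature form of the equation is matched by means of nab_C C = 0, zero torsion and A^2 = 0. *)
Lemma jacobi_reduction : nab (z0 + x0) (z0 + x0) = 0 ->
  exists A B, [/\ forall x, x *m A = br x0 x,
    forall x w, ip (x *m B) w = ip (br x w) (z0 + x0) + ip (br x0 w) x &
    forall Y, N2_is_jacobi nab br (fun=> z0 + x0) Y <->
      exists X, (forall t, is_derive t (1 : R) Y (X t)) /\
        forall t, is_derive t (1 : R) (fun s => X s + Y s *m A) ((X t + Y t *m A) *m B)].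
Proof.
set C := z0 + x0 => nabC.
have [L LE] := linear_mulmxE (fun a x y => nab_linr a x y C).
have [A AE] := linear_mulmxE (fun a x y => br_linr a x y C).
have brC x : br C x = br x0 x by rewrite /C brDl z0_center add0r.
have AA x : x *m A *m A = 0 by rewrite -!AE brC center_br//; exact: br_center.
exists A, (A - 2 *: L); split.
- by move=> x; rewrite -AE brC.
- move=> x w; rewrite mulmxBr -scalemxAr -AE -LE ipBl ipZl nab_LC -(brC w) [br w C]br_anti ipNl; ring.
have curvE u : N2_curv nab br u C C = 2 *: (u *m A *m L) - u *m L *m L.
  have brE : br u C = - (u *m A) by rewrite br_anti AE.
  have nab0 : nab u 0 = 0.
    by have /eqP := nab_linr 1 0 0 u; rewrite !scale1r addr0 -subr_eq0 opprD addNKr oppr_eq0 => /eqP.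
  rewrite /N2_curv nabC nab0 (nab_torsion u C) (nab_torsion (br u C) C) (br_center u C C) addr0.
  rewrite !LE brE mulmxBl mulNmx.
  by move: (u *m A *m L) (u *m L *m L) => p q; apply/rowP => i; rewrite !mxE; ring.
(* Here u, x and v stand for Y, Y' and the derivative of the covariant derivative Y' + Y L. *)
have algebra u x v : (v - x *m L + x *m A = (x + u *m A) *m (A - 2 *: L)) <->
    v + (x + u *m L) *m L + N2_curv nab br u C C = 0.
  rewrite curvE mulmxBr !mulmxDl -!scalemxAr AA addr0.
  move: (u *m A *m L) (u *m L *m L) (x *m L) (x *m A) => p q r s.
  split=> [/eqP|e].
    rewrite -subr_eq0 => /eqP e; rewrite -[RHS]e; apply/rowP => i; rewrite !mxE; ring.
  apply/eqP; rewrite -subr_eq0; apply/eqP; rewrite -[RHS]e; apply/rowP => i; rewrite !mxE; ring.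
have DcovE Y X t : (forall s, is_derive s (1 : R) Y (X s)) -> N2_Dcov nab (fun=> C) Y t = X t + Y t *m L.
  by move=> dY; rewrite /N2_Dcov derive1E LE; have [_ ->] := dY t.
move=> Y; split=> [[dY [dU jac]]|[X [dY dZ]]].
- have [X dY'] : exists X, forall t, is_derive t (1 : R) Y (X t).
    by exists (derive1 Y) => t; rewrite derive1E; exact: derivableP.
  exists X; split=> // t.
  set U := N2_Dcov nab _ Y in dU jac.
  have UE s : U s = X s + Y s *m L by exact: DcovE.
  have dU' s : is_derive s (1 : R) U (derive1 U s) by rewrite derive1E; exact: derivableP.
  have dYL := is_derive_mulmxr L (dY' t); have dYA := is_derive_mulmxr A (dY' t).
  apply: (is_derive_ext (is_deriveD (is_deriveB (dU' t) dYL) dYA)) => [s|].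
    by rewrite -[LHS]/(U s - Y s *m L + Y s *m A) UE addrK.
  have e : N2_Dcov nab (fun=> C) U t = derive1 U t + U t *m L by rewrite /N2_Dcov LE.
  by apply/algebra; have := jac t; rewrite e UE.
- have dX t : is_derive t (1 : R) X ((X t + Y t *m A) *m (A - 2 *: L) - X t *m A).
    apply: (is_derive_ext (is_deriveB (dZ t) (is_derive_mulmxr A (dY t)))) => // s.
    by rewrite -[LHS]/(X s + Y s *m A - Y s *m A) addrK.
  have dU t : is_derive t (1 : R) (N2_Dcov nab (fun=> C) Y)
      ((X t + Y t *m A) *m (A - 2 *: L) - X t *m A + X t *m L).
    apply: (is_derive_ext (is_deriveD (dX t) (is_derive_mulmxr L (dY t)))) => // s.
    by rewrite (DcovE _ _ _ dY).
  split; first by move=> t; have [] := dY t.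
  split=> t; first by have [] := dU t.
  rewrite {1}/N2_Dcov derive1E LE; have [_ ->] := dU t.
  rewrite (DcovE _ _ _ dY); apply/algebra.
  by rewrite addrK subrK.
Qed.

End Geodesic.
End Nilpotent.

(** * The case [J = 0] *)

Section SquareZeroSystem.
Variables (R : realType) (n : nat) (A B : 'M[R]_n).
Hypotheses (AA : A *m A = 0) (BB : B *m B = 0).
Local Notation V := 'rV[R]_n.

Definition jacobi_system (Y : R -> V) : Prop :=
  exists X : R -> V, (forall t, is_derive t (1 : R) Y (X t)) /\
    forall t, is_derive t (1 : R) (fun s => X s + Y s *m A) ((X t + Y t *m A) *m B).

(** The solution with Y 0 = 0 and Y' 0 = v. As B^2 = 0, the quantity Y' + Y A equals v + t v B; as
    A^2 = 0, integrating this equation for Y stops at degree three. *)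
Definition cubic (v : V) (t : R) : V :=
  t *: v + (t ^+ 2 / 2) *: (v *m (B - A)) + (- (t ^+ 3 / 6)) *: (v *m B *m A).

Definition cubic_velocity (v : V) (t : R) : V :=
  v + t *: (v *m (B - A)) + (- (t ^+ 2 / 2)) *: (v *m B *m A).

Lemma is_derive_cubic v t : is_derive t (1 : R) (cubic v) (cubic_velocity v t).
Proof.
have d1 := is_derive_id t (1 : R).
have d2 : is_derive t (1 : R) (fun s => s ^+ 2 / 2) t.
  apply: (is_derive_ext (is_deriveZ 2^-1 (is_deriveM d1 d1))) => [s|].
    by rewrite expr2 [LHS]mulrC.
  by rewrite /= /GRing.scale /=; field.
have d3 : is_derive t (1 : R) (fun s => - (s ^+ 3 / 6)) (- (t ^+ 2 / 2)).
  apply: (is_derive_ext (is_deriveZ (- 6^-1) (is_deriveM d1 (is_deriveM d1 d1)))) => [s|].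
    by rewrite [LHS]mulNr exprS expr2 [in RHS]mulrC.
  by change (- 6^-1 * (t * (t * 1 + t * 1) + (t * t) * 1) = - (t ^+ 2 / 2)); field.
apply: (is_derive_ext (is_deriveD (is_deriveD (is_derive_scalel v d1)
  (is_derive_scalel (v *m (B - A)) d2)) (is_derive_scalel (v *m B *m A) d3))) => //.
by rewrite scale1r.
Qed.

Lemma cubic_twisted_velocity v t : cubic_velocity v t + cubic v t *m A = v + t *: (v *m B).
Proof.
rewrite /cubic_velocity /cubic !mulmxDl -!scalemxAl mulmxBr mulmxBl -!(mulmxA _ A A) AA !mulmx0.
by move: (v *m A) (v *m B) (v *m B *m A) => p q r; apply/rowP => i; rewrite !mxE; field.
Qed.

Lemma cubic_system v : jacobi_system (cubic v).
Proof.
exists (cubic_velocity v); split=> t; first exact: is_derive_cubic.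
apply: (is_derive_ext (is_deriveD (is_derive_cst v t (1 : R))
  (is_derive_scalel (v *m B) (is_derive_id t (1 : R))))) => [s|].
  by rewrite cubic_twisted_velocity.
by rewrite cubic_twisted_velocity mulmxDl -scalemxAl -mulmxA BB mulmx0 scaler0 addr0 add0r scale1r.
Qed.

(** Uniqueness is used twice for the difference D with the cubic of the same initial velocity: first
    D' + D A = 0, then D = 0. *)
Lemma jacobi_system_cubic Y : jacobi_system Y -> Y 0 = 0 -> exists v, Y = cubic v.
Proof.
move=> [X [dY dZ]] Y0; exists (X 0).
pose D t := Y t - cubic (X 0) t; pose DX t := X t - cubic_velocity (X 0) t.
have dD t : is_derive t (1 : R) D (DX t) := is_deriveB (dY t) (is_derive_cubic (X 0) t).
have cubic0 : cubic (X 0) 0 = 0 by rewrite /cubic !expr0n /= !mul0r oppr0 !scale0r !addr0.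
have W0 : forall t, DX t + D t *m A = 0.
  have dW t : is_derive t (1 : R) (fun s => DX s + D s *m A) ((DX t + D t *m A) *m B).
    have WE s : DX s + D s *m A = (X s + Y s *m A) - (X 0 + s *: (X 0 *m B)).
      by rewrite -cubic_twisted_velocity /DX /D mulmxBl (opprD (cubic_velocity _ _)) addrACA.
    have dl := is_deriveD (is_derive_cst (X 0) t (1 : R))
      (is_derive_scalel (X 0 *m B) (is_derive_id t (1 : R))).
    apply: (is_derive_ext (is_deriveB (dZ t) dl)) => [s|]; first by rewrite WE.
    by rewrite WE mulmxBl add0r scale1r (mulmxDl (X 0)) -scalemxAl -(mulmxA (X 0)) BB mulmx0 scaler0 addr0.
  apply: (linear_ode_unique (t0 := 0) dW).
  rewrite /DX /D Y0 cubic0 subrr mul0mx addr0 /cubic_velocity expr0n /= mul0r oppr0 !scale0r !addr0.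
  by rewrite subrr.
have dD' t : is_derive t (1 : R) D (D t *m (- A)).
  apply: (is_derive_ext (dD t)) => //; rewrite mulmxN; apply/eqP.
  by rewrite -addr_eq0 W0.
apply/funext => t; apply/eqP; rewrite -subr_eq0; apply/eqP.
by apply: (linear_ode_unique (t0 := 0) dD'); rewrite /D Y0 cubic0 subrr.
Qed.

(** The cubic is parametrised by z = v + (T / 2) v B instead of its initial velocity v; B^2 = 0
    gives z B = v B, so v is recovered from z. When the cubic vanishes at T, z lies in the image of
    A. *)
Definition conjugate_field (T : R) (z : V) : R -> V := cubic (z - (T / 2) *: (z *m B)).

Lemma cubic_linear a x y t : cubic (a *: x + y) t = a *: cubic x t + cubic y t.
Proof.
rewrite /cubic !mulmxDl -!scalemxAl.
move: (x *m (B - A)) (y *m (B - A)) (x *m B *m A) (y *m B *m A) => p q r s.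
by apply/rowP => i; rewrite !mxE; ring.
Qed.

Lemma conjugate_field_linear T a x y t :
  conjugate_field T (a *: x + y) t = a *: conjugate_field T x t + conjugate_field T y t.
Proof.
rewrite /conjugate_field -cubic_linear; congr cubic.
rewrite mulmxDl -scalemxAl; move: (x *m B) (y *m B) => p q.
by apply/rowP => i; rewrite !mxE; ring.
Qed.

Lemma conjugate_field_eq0 T z : conjugate_field T z = (fun=> 0) -> z = 0.
Proof.
rewrite /conjugate_field; set v := z - _ => v0.
have {}v0 : v = 0.
  have := is_derive_cubic v 0; rewrite v0 => -[_].
  rewrite derive_cst /cubic_velocity expr0n /= mul0r oppr0 !scale0r !addr0.
  by move=> <-.
have zE : z = (T / 2) *: (z *m B) by apply/eqP; rewrite -subr_eq0 -/v v0.
by rewrite zE {1}zE -scalemxAl -mulmxA BB mulmx0 !scaler0.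
Qed.

Lemma conjugate_field_vanish T z : T != 0 -> z *m A = 0 ->
  z *m B *m A = (- 12 / T ^+ 2) *: z -> conjugate_field T z T = 0.
Proof.
move=> T0 zA zBA; rewrite /conjugate_field /cubic !mulmxBr !mulmxBl -!scalemxAl.
rewrite -!(mulmxA z B B) BB !mulmx0 mul0mx zA zBA.
by move: (z *m B) => p; apply/rowP => i; rewrite !mxE; field.
Qed.

(** Dividing the vanishing cubic by T gives z = (T / 2) v A + (T^2 / 6) v B A. Then z A = 0, so v A
    = - (T / 2) z B A, and substitution yields z = (- 1/4 + 1/6) T^2 z B A. This is the origin of
    the 12. *)
Lemma cubic_vanish T v : T != 0 -> cubic v T = 0 ->
  exists z u, [/\ z = u *m A, z *m B *m A = (- 12 / T ^+ 2) *: z & cubic v = conjugate_field T z].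
Proof.
move=> T0 vT.
pose z := v + (T / 2) *: (v *m B).
have zB : z *m B = v *m B by rewrite mulmxDl -scalemxAl -mulmxA BB mulmx0 scaler0 addr0.
have vE : v = z - (T / 2) *: (z *m B) by rewrite zB addrK.
have zE : z = (T / 2) *: (v *m A) + (T ^+ 2 / 6) *: (v *m B *m A).
  have : T^-1 *: cubic v T = 0 by rewrite vT scaler0.
  rewrite /cubic /z mulmxBr; move: (v *m A) (v *m B) (v *m B *m A) => p q r e.
  apply/eqP; rewrite -subr_eq0; apply/eqP; rewrite -[RHS]e.
  by apply/rowP => i; rewrite !mxE; field.
have zu : z = ((T / 2) *: v + (T ^+ 2 / 6) *: (v *m B)) *m A.
  by rewrite mulmxDl -!scalemxAl.
have zA : z *m A = 0 by rewrite zu -mulmxA AA mulmx0.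
exists z, ((T / 2) *: v + (T ^+ 2 / 6) *: (v *m B)); split=> //; last by rewrite /conjugate_field -vE.
have vA : v *m A = (- (T / 2)) *: (z *m B *m A).
  by rewrite {1}vE mulmxBl zA -scalemxAl sub0r scaleNr.
move: zE; rewrite -zB vA; move: (z *m B *m A) => p zE.
by apply/rowP => i; move/rowP/(_ i): zE; rewrite !mxE => ->; field.
Qed.

End SquareZeroSystem.

Section ConjugatePoints.
Variables (R : realType) (n : nat) (G : 'M[R]_n).
Local Notation V := 'rV[R]_n.
Variables (br nab Jf : V -> V -> V).
Hypotheses (Gsym : G^T = G) (Gunit : G \in unitmx) (br_two_step : N2_two_step br).
Hypothesis center_nondeg :
  forall z, N2_center br z -> (forall w, N2_center br w -> N2_ip G z w = 0) -> z = 0.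
Hypotheses (nab_LC : N2_levi_civita G br nab) (Jf_J : N2_J_map G br Jf).
Local Notation ip := (N2_ip G).
Local Notation center := (N2_center br).
Local Notation vpart := (N2_vpart G br).
Variables (z0 x0 : V) (c : R -> V).
Hypotheses (z0_center : center z0) (x0_vpart : vpart x0).
Hypotheses (c_derivable : forall t, derivable c t 1)
  (c_geodesic : forall t, derive1 c t + nab (c t) (c t) = 0) (c0 : c 0 = z0 + x0).

Let eigen T (z : V) := center z /\ br x0 (Jf z x0) + (12 / T ^+ 2) *: z = 0.

(** An injective linear parametrisation of the fields vanishing at 0 and T by an eigenspace of z ->
    [x0, J_z x0]; both the criterion and the multiplicity follow from it. *)
Lemma degenerate_jacobi_fields : (forall x, vpart x -> Jf z0 x = 0) ->
  exists phi : R -> V -> R -> V,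
    (forall T a x y t, phi T (a *: x + y) t = a *: phi T x t + phi T y t) /\
    (forall T z, phi T z = (fun=> 0) -> z = 0) /\
    forall T Y, T != 0 -> N2_Jac0 nab br c T Y <-> exists2 z, eigen T z & Y = phi T z.
Proof.
move=> J0.
have [cE nabC] := constant_geodesic Gsym Gunit br_two_step center_nondeg nab_LC Jf_J z0_center
  x0_vpart c_derivable c_geodesic c0 (or_introl J0).
have [A [B [AE ipB jacE]]] := jacobi_reduction Gsym Gunit br_two_step nab_LC z0_center nabC.
have br_cent := br_center br_two_step.
have ipB' x w : ip (x *m B) w = ip (br x0 w) x.
  rewrite ipB (ipDr Gsym) (ip_br_z0 Gsym br_two_step center_nondeg Jf_J z0_center J0) add0r.
  by rewrite x0_vpart ?add0r.
have AA : A *m A = 0.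
  apply/row_matrixP => i; rewrite row0 row_mul rowE !AE.
  by rewrite (center_br br_two_step).
(* The pairing of y B^2 with w is that of y with [x0, [x0, w]], which is zero in a 2-step
   algebra. *)
have BB : B *m B = 0.
  apply/row_matrixP => i; rewrite row0 row_mul rowE; apply: (ip_nondeg Gunit) => w.
  rewrite ipB' (ipC Gsym) ipB' [br x0 (br _ _)](center_br br_two_step)//.
  by rewrite ip0l.
have BE z : center z -> z *m B = Jf z x0.
  move=> cz; apply: (ip_eq Gunit) => w; rewrite ipB' (ip_Jf Gsym br_two_step center_nondeg Jf_J)//.
  exact: ipC.
have eigenE T z : eigen T z <-> center z /\ z *m B *m A = (- 12 / T ^+ 2) *: z.
  split=> -[cz e]; split=> //.
    by rewrite BE// AE; apply/eqP; rewrite -subr_eq0 mulNr scaleNr opprK e.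
  by rewrite -AE -BE// e mulNr scaleNr addNr.
exists (conjugate_field A B); split; first exact: conjugate_field_linear.
split; first exact: conjugate_field_eq0.
move=> T Y T0; rewrite /N2_Jac0 cE; split=> [[/jacE sysY [Y0 YT]]|[z /eigenE[cz zBA] ->]].
  have [v Yv] := jacobi_system_cubic AA BB sysY Y0.
  have [z [u [zu zBA vz]]] : exists z u, [/\ z = u *m A, z *m B *m A = (- 12 / T ^+ 2) *: z
      & cubic A B v = conjugate_field A B T z].
    by apply: cubic_vanish => //; rewrite -Yv.
  exists z; last by rewrite Yv.
  (* z = u A is the bracket [x0, u], hence central. *)
  by apply/eigenE; split=> //; rewrite zu AE.
split; first by apply/jacE; exact: cubic_system.
split; first by rewrite /conjugate_field /cubic !expr0n /= !mul0r oppr0 !scale0r !addr0.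
by apply: conjugate_field_vanish => //; rewrite AE (center_br br_two_step).
Qed.

Lemma degenerate_conjugate_pt T : T != 0 -> (forall x, vpart x -> Jf z0 x = 0) ->
  N2_conjugate_pt nab br c T <->
    exists z, center z /\ z != 0 /\ br x0 (Jf z x0) = (- 12 / T ^+ 2) *: z.
Proof.
move=> T0 J0; have [phi [lin [inj jac]]] := degenerate_jacobi_fields J0.
split=> [[Y [/jac-/(_ T0)[z [cz ez] ->] Yn0]]|[z [cz [zn0 ez]]]].
  exists z; split=> //; split.
    apply: contra_notN Yn0 => /eqP ->; apply/funext => t.
    by have := lin T (-1) 0 0 t; rewrite scaler0 addr0 scaleN1r addNr.
  by apply/eqP; rewrite -subr_eq0 mulNr scaleNr opprK ez.
exists (phi T z); split; last by move=> /inj z00; rewrite z00 eqxx in zn0.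
by apply/jac => //; exists z => //; split=> //; rewrite ez mulNr scaleNr addNr.
Qed.

Lemma degenerate_multiplicity T d : T != 0 -> (forall x, vpart x -> Jf z0 x = 0) ->
  N2_has_dimV (eigen T) d ->
  N2_has_dimF (N2_Jac0 nab br c T) d /\ forall m, N2_has_dimV center m -> (d <= m)%N.
Proof.
move=> T0 J0 dimE; split; last first.
  by move=> m dimC; apply: (has_dim_le (S := eigen T) (S' := center) _ dimE dimC) => x [].
have [phi [lin [inj jac]]] := degenerate_jacobi_fields J0.
apply/has_dimFP.
apply: (has_dim_image (U' := (R -> V : lmodType R)) (phi := phi T) _ _ _ dimE).
- by move=> a x y; apply/funext => t; exact: lin.
- exact: inj.
- by move=> Y; split=> [/jac|h]; [apply|apply/jac].
Qed.

End ConjugatePoints.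

(** * The case [x0 = 0] *)

Section CentralGeodesic.
Variables (R : realType) (n : nat) (G : 'M[R]_n.+1).
Local Notation V := 'rV[R]_n.+1.
Variables (br nab Jf : V -> V -> V).
Hypotheses (Gsym : G^T = G) (Gunit : G \in unitmx) (br_two_step : N2_two_step br).
Hypothesis center_nondeg :
  forall z, N2_center br z -> (forall w, N2_center br w -> N2_ip G z w = 0) -> z = 0.
Hypotheses (nab_LC : N2_levi_civita G br nab) (Jf_J : N2_J_map G br Jf).
Local Notation ip := (N2_ip G).
Local Notation center := (N2_center br).
Local Notation vpart := (N2_vpart G br).
Variables (z0 : V) (c : R -> V).
Implicit Types (x y w : V) (Y : R -> V).
Hypothesis z0_center : center z0.
Hypotheses (c_derivable : forall t, derivable c t 1)
  (c_geodesic : forall t, derive1 c t + nab (c t) (c t) = 0) (c0 : c 0 = z0 + 0).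

Lemma central_jacobi_bvp : exists B : 'M[R]_n.+1,
  [/\ forall x w, ip (x *m B) w = ip (br x w) z0, forall x, vpart (x *m B),
      forall x, vpart x -> x *m B = Jf z0 x &
      forall T Y, N2_Jac0 nab br c T Y <-> bvp B T Y].
Proof.
have v0 : vpart 0 := (vpart_subspace br Gsym).1.
have [cE nabC] := constant_geodesic Gsym Gunit br_two_step center_nondeg nab_LC Jf_J z0_center
  v0 c_derivable c_geodesic c0 (or_intror erefl).
have [A [B [AE ipB jacE]]] := jacobi_reduction Gsym Gunit br_two_step nab_LC z0_center nabC.
have A0 x : x *m A = 0 by rewrite AE (br0l br_two_step).
have ipB' x w : ip (x *m B) w = ip (br x w) z0.
  by rewrite ipB (br0l br_two_step) ip0l !addr0.
exists B; split; first exact: ipB'.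
- by move=> x w cw; rewrite (ipC Gsym) ipB' (center_br br_two_step)// ip0l.
- move=> x vx; apply: (ip_eq Gunit) => w.
  by rewrite ipB' (ip_Jf Gsym br_two_step center_nondeg Jf_J)// (ipC Gsym).
move=> T Y; rewrite /N2_Jac0 cE; split=> [[/jacE[X [dY dZ]] YT]|[[X [dY dX]] YT]].
  split; last exact: YT.
  exists X; split=> t; first exact: dY.
  by apply: (is_derive_ext (dZ t)) => [s|]; rewrite A0 addr0.
split; last exact: YT.
apply/jacE; exists X; split=> t; first exact: dY.
by apply: (is_derive_ext (dX t)) => [s|]; rewrite A0 addr0.
Qed.

Lemma central_degenerate_no_conjugate_pt T : T != 0 ->
  (forall x, vpart x -> Jf z0 x = 0) -> ~ N2_conjugate_pt nab br c T.
Proof.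
move=> T0 J0 [Y [jacY Y0]].
have [B [ipB _ _ jacE]] := central_jacobi_bvp.
have B0 x : x *m B = 0.
  by apply: (ip_nondeg Gunit) => w; rewrite ipB (ip_br_z0 Gsym br_two_step center_nondeg Jf_J z0_center J0).
have bY : bvp B T Y by apply/jacE.
apply: Y0; apply/funext => t; apply/eqP; apply: contraT => Yt.
(* Since B = 0, the field has eigenvalue 0, while a nonzero solution requires a strictly negative
   one. *)
have [|h [h_gt0 /esym/eqP]] := @bvp_eigen _ _ B T Y 0 T0 bY (ex_intro _ t Yt).
  by move=> s; rewrite raddf0 subr0 mulmxA !B0.
by rewrite oppr_eq0 sqrf_eq0 gt_eqF.
Qed.

Section Spectrum.
Variable lams : seq R.
Hypothesis lams_uniq : uniq lams.
Hypothesis lamsP : forall l, l \in lams <->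
  (0 < l /\ exists x, vpart x /\ x != 0 /\ Jf z0 (Jf z0 x) = (- l ^+ 2) *: x).

Lemma lams_gt0 l : l \in lams -> 0 < l.
Proof. by move/lamsP => []. Qed.

Section WithMatrix.
Variable B : 'M[R]_n.+1.
Hypotheses (vpartB : forall x, vpart (x *m B)) (JfB : forall x, vpart x -> x *m B = Jf z0 x).

Let eigenspace h x := x *m (B *m B) = - h ^+ 2 *: x.

(** An eigenvector of B^2 with nonzero eigenvalue lies in the image of B, hence in v, where B is J.
    Passing from J on v to the matrix B thus creates no new negative eigenvalue and no extra
    multiplicity. *)
Lemma eigenspaceE h x : 0 < h ->
  eigenspace h x <-> vpart x /\ Jf z0 (Jf z0 x) + h ^+ 2 *: x = 0.
Proof.
move=> h0; have J2 y : vpart y -> Jf z0 (Jf z0 y) = y *m (B *m B).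
  by move=> vy; rewrite -(JfB vy) -JfB// mulmxA.
rewrite /eigenspace; split=> [e|[vx e]]; last first.
  by apply/eqP; rewrite -J2// scaleNr -addr_eq0 e.
have vx : vpart x.
  have -> : x = (- h ^- 2) *: (x *m B *m B) + 0.
    rewrite addr0 -mulmxA e scalerA mulNr mulrN opprK mulVf ?scale1r//.
    by rewrite sqrf_eq0 gt_eqF.
  by apply: (vpart_subspace br Gsym).2 => //; exact: (vpart_subspace br Gsym).1.
by split=> //; rewrite J2// e scaleNr addNr.
Qed.

Lemma eigenspace_subspace h : is_subspace (eigenspace h).
Proof.
split=> [|a x y ex ey]; first by rewrite /eigenspace mul0mx scaler0.
by rewrite /eigenspace mulmxDl -scalemxAl ex ey scalerDr !scalerA mulrC.
Qed.

Lemma eigen_lams h x : 0 < h -> x != 0 -> eigenspace h x -> h \in lams.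
Proof.
move=> h0 xn0 /(eigenspaceE x h0)[vx e]; apply/lamsP; split=> //; exists x; split=> //; split=> //.
by apply/eqP; rewrite scaleNr -addr_eq0 e.
Qed.

(** P is any boolean test that agrees with resonance on the spectrum: resonance itself for the
    criterion, divisibility of frequencies for the multiplicity. *)
Lemma bvp_lams T (P : pred R) Y : T != 0 -> (forall h, h \in lams -> P h <-> resonant T h) ->
  bvp B T Y <-> sum_spaces (U := (R -> V : lmodType R)) (harmonic_space B T) [seq h <- lams | P h] Y.
Proof.
move=> T0 PE; split=> [bY|]; last first.
  by apply: sum_spaces_le; [exact: bvp_subspace|move=> h _ Z []].
apply: bvp_decomposition T0 _ bY => h h0 res [x xn0 ex].
have h_lams := eigen_lams h0 xn0 ex.
by rewrite mem_filter h_lams andbT; apply/PE.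
Qed.

(** A field of frequency h is determined by its initial velocity, which ranges over the whole
    eigenspace because resonance makes every such harmonic vanish at T. *)
Lemma harmonic_space_dim T h d : h \in lams -> resonant T h ->
  N2_has_dimV (fun x => vpart x /\ Jf z0 (Jf z0 x) + h ^+ 2 *: x = 0) d ->
  has_dim (U := (R -> V : lmodType R)) (harmonic_space B T h) d.
Proof.
move=> /lams_gt0 h0 res dimE; have hn0 : h != 0 by rewrite gt_eqF.
apply: (has_dim_image (U' := (R -> V : lmodType R)) (phi := harmonic B h) _ _ _ dimE).
- by move=> a x y; apply/funext => t; exact: harmonic_linear.
- by move=> x x0; apply: (harmonic_eq0 (B := B) hn0) => t; rewrite x0.
- move=> Y; split=> [[[[X [dY dX]] [Y0 YT]] YM]|[x /(eigenspaceE x h0) ex ->]].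
    have XM : X 0 *m (B *m B) = - h ^+ 2 *: X 0.
      have YN t : Y t *m (B *m B + (h ^+ 2)%:M) = 0.
        by rewrite mulmxDr mul_mx_scalar YM scaleNr addNr.
      have /eqP := mulmx_velocity_eq0 dY YN 0.
      by rewrite mulmxDr mul_mx_scalar addr_eq0 scaleNr => /eqP.
    exists (X 0); first exact/eigenspaceE.
    by have [] := harmonic_unique hn0 dY dX Y0 XM.
  split; first exact: harmonic_bvp.
  move=> t; rewrite harmonic_mulmx ?mulmxA//.
  have h0x : harmonic B h 0 t = 0 by rewrite /harmonic mul0mx !scaler0 addr0.
  by rewrite -mulmxA ex -[_ *: x]addr0 harmonic_linear h0x addr0.
Qed.

End WithMatrix.

Lemma central_conjugate_pt T : T != 0 ->
  N2_conjugate_pt nab br c T <->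
    exists l (k : int), l \in lams /\ k != 0 /\ T = 2 * pi / l * k%:~R.
Proof.
move=> T0; have [B [_ vpartB JfB jacE]] := central_jacobi_bvp.
split=> [[Y [/jacE bY Yn0]]|[l [k [l_lams [k0 TE]]]]].
  pose P h := `[< resonant T h >].
  have /(bvp_lams vpartB JfB Y T0) : forall h, h \in lams -> P h <-> resonant T h.
    by move=> h _; split=> /asboolP.
  move=> /iffLR /(_ bY).
  (* Without resonant frequencies the sum of harmonic spaces is trivial, so Y would be zero. *)
  case E : [seq h <- lams | P h] => [|l s] sY; first by case: Yn0; exact: sY.
  have : l \in [seq h <- lams | P h] by rewrite E mem_head.
  rewrite mem_filter => /andP[/asboolP[k k0 Tl] l_lams]; exists l, k; split=> //; split=> //.
  by rewrite mulrAC -Tl mulfK// gt_eqF// lams_gt0.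
have [l0 [x [vx [xn0 ex]]]] := (lamsP l).1 l_lams.
have ln0 : l != 0 by rewrite gt_eqF.
exists (harmonic B l x); split.
  apply/jacE; apply: harmonic_bvp => //.
    by exists k => //; rewrite TE mulrAC divfK.
  by apply/(eigenspaceE vpartB JfB x l0); split=> //; rewrite ex scaleNr addNr.
move=> H; case/eqP: xn0; apply: (harmonic_eq0 (B := B) ln0) => t.
by rewrite H.
Qed.

Lemma central_multiplicity lk (k : int) (d : R -> nat) : lk \in lams -> k != 0 ->
  (forall h, h \in lams ->
     N2_has_dimV (fun x => vpart x /\ Jf z0 (Jf z0 x) + h ^+ 2 *: x = 0) (d h)) ->
  N2_has_dimF (N2_Jac0 nab br c (2 * pi / lk * k%:~R))
    (\sum_(h <- lams | `[< N2_rdvd (lk / k%:~R) h >]) d h) /\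
  forall p, N2_has_dimV vpart p ->
    (\sum_(h <- lams | `[< N2_rdvd (lk / k%:~R) h >]) d h <= p)%N.
Proof.
move=> lk_lams k0 dimE; set T := 2 * pi / lk * k%:~R.
pose P (h : R) := `[< N2_rdvd (lk / k%:~R) h >].
have lk0 : lk != 0 by rewrite gt_eqF// lams_gt0.
have kR0 : k%:~R != 0 :> R by rewrite intr_eq0.
have pi0 : pi != 0 :> R by rewrite gt_eqF// pi_gt0.
have T0 : T != 0 by rewrite !mulf_neq0 ?invr_eq0 ?pnatr_eq0.
(* T lk / k = 2 pi, so T h = 2 pi m says exactly that h = m (lk / k). *)
have PE h : P h <-> resonant T h.
  split=> [/asboolP[m [m0 hE]]|[m m0 Th]].
    by exists m => //; rewrite hE /T; field; rewrite kR0 lk0.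
  apply/asboolP; exists m; split=> //.
  have -> : h = T * h / T by rewrite mulrAC divff// mul1r.
  rewrite Th /T; move: (pi : R) pi0 => p p0.
  by field; rewrite kR0 lk0 p0.
have [B [_ vpartB JfB jacE]] := central_jacobi_bvp.
have mu_inj : {in [seq h <- lams | P h] &, injective (fun h : R => - h ^+ 2)}.
  move=> h h' /=; rewrite !mem_filter => /andP[_ /lams_gt0 h0] /andP[_ /lams_gt0 h0'].
  by move=> /oppr_inj /eqP; rewrite eqrXn2 ?ltW// => /eqP.
rewrite -(big_filter lams P); split.
  apply/has_dimFP.
  apply: (has_dim_eq (S := sum_spaces (U := (R -> V : lmodType R)) (harmonic_space B T)
    [seq h <- lams | P h])).
    by move=> Y; split=> [sY|/jacE bY]; [apply/jacE|]; apply/(bvp_lams vpartB JfB Y T0 (P := P)).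
  apply: (has_dim_sum_spaces (f := fun (Y : (R -> V : lmodType R)) t => Y t *m (B *m B)) _ _ mu_inj).
  - by move=> a Y Z; apply/funext => t; rewrite -[LHS]/((a *: Y t + Z t) *m (B *m B)) mulmxDl -scalemxAl.
  - exact: filter_uniq.
  - exact: harmonic_space_subspace.
  - by move=> h _ Y [_ YM]; apply/funext => t; exact: YM.
  - move=> h; rewrite mem_filter => /andP[/PE res h_lams].
    exact: (harmonic_space_dim vpartB JfB h_lams res (dimE h h_lams)).
move=> p dimv.
(* The sum of the multiplicities is the dimension of a direct sum of eigenspaces of B^2, all
   contained in v; hence the bound. *)
pose S h x := x *m (B *m B) = - h ^+ 2 *: x.
have dimS : has_dim (sum_spaces S [seq h <- lams | P h]) (\sum_(h <- [seq h <- lams | P h]) d h).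
  apply: (has_dim_sum_spaces (f := fun x : V => x *m (B *m B)) _ _ mu_inj).
  - by move=> a x y; rewrite mulmxDl -scalemxAl.
  - exact: filter_uniq.
  - exact: eigenspace_subspace.
  - by [].
  - move=> h; rewrite mem_filter => /andP[_ h_lams].
    apply: has_dim_eq (dimE h h_lams) => x.
    exact: iff_sym (eigenspaceE vpartB JfB x (lams_gt0 h_lams)).
apply: (has_dim_le _ dimS dimv) => x.
apply: sum_spaces_le; first exact: (vpart_subspace br Gsym).
move=> h; rewrite mem_filter => /andP[_ /lams_gt0 h0] y.
by move=> /(eigenspaceE vpartB JfB y h0)[].
Qed.

End Spectrum.
End CentralGeodesic.

(** * The three cases assembled *)

Unset Implicit Arguments.

Theorem mainTheorem3 (R : realType) (n : nat)
  (G : 'M[R]_n) (br nab Jf : 'rV[R]_n -> 'rV[R]_n -> 'rV[R]_n)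
  (z0 x0 : 'rV[R]_n) (c : R -> 'rV[R]_n) :
  G^T = G -> G \in unitmx ->
  N2_two_step br ->
  (forall z, N2_center br z -> (forall w, N2_center br w -> N2_ip G z w = 0) -> z = 0) ->
  N2_levi_civita G br nab ->
  N2_J_map G br Jf ->
  N2_center br z0 -> N2_vpart G br x0 ->
  (forall t, derivable c t 1) ->
  (forall t, derive1 c t + nab (c t) (c t) = 0) ->
  c 0 = z0 + x0 ->
  (* (1) *)
  ((forall x, N2_vpart G br x -> Jf z0 x = 0) -> x0 = 0 ->
     forall t, t != 0 -> ~ N2_conjugate_pt nab br c t) /\
  (* (2) *)
  ((forall x, N2_vpart G br x -> Jf z0 x = 0) -> x0 != 0 ->
     forall t, t != 0 ->
       (N2_conjugate_pt nab br c t <->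
          exists z, N2_center br z /\ z != 0 /\
            br x0 (Jf z x0) = (- 12 / t ^+ 2) *: z) /\
       (N2_conjugate_pt nab br c t ->
          forall d, N2_has_dimV (fun z => N2_center br z /\
                       br x0 (Jf z x0) + (12 / t ^+ 2) *: z = 0) d ->
            N2_has_dimF (N2_Jac0 nab br c t) d /\
            forall m, N2_has_dimV (N2_center br) m -> (d <= m)%N)) /\
  (* (3) *)
  ((exists x, N2_vpart G br x /\ Jf z0 x != 0) -> x0 = 0 ->
     forall lams : seq R, uniq lams ->
       (forall l, l \in lams <->
          (0 < l /\ exists x, N2_vpart G br x /\ x != 0 /\
                       Jf z0 (Jf z0 x) = (- l ^+ 2) *: x)) ->
       (forall t, t != 0 ->
          (N2_conjugate_pt nab br c t <->
             exists l (k : int), l \in lams /\ k != 0 /\ t = 2 * pi / l * k%:~R)) /\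
       (forall lk (k : int), lk \in lams -> k != 0 ->
          forall d : R -> nat,
            (forall h, h \in lams ->
               N2_has_dimV (fun x => N2_vpart G br x /\ Jf z0 (Jf z0 x) + h ^+ 2 *: x = 0) (d h)) ->
            N2_has_dimF (N2_Jac0 nab br c (2 * pi / lk * k%:~R))
              (\sum_(h <- lams | `[< N2_rdvd (lk / k%:~R) h >]) d h) /\
            forall p, N2_has_dimV (N2_vpart G br) p ->
              (\sum_(h <- lams | `[< N2_rdvd (lk / k%:~R) h >]) d h <= p)%N)).
Proof.
move=> Gsym Gunit two_step nondeg nab_LC Jf_J z0_center x0_vpart dc geo c0.
case: n G br nab Jf z0 x0 c Gsym Gunit two_step nondeg nab_LC Jf_J z0_center x0_vpart dc geo c0
    => [|m] {}G {}br {}nab {}Jf {}z0 {}x0 {}c Gsym Gunit two_step nondeg nab_LC Jf_J z0_center x0_vpart dc geo c0.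
  (* A 2-step algebra has a nonzero bracket, so n > 0, and polynomials can be evaluated in a ring of
     square matrices. *)
  by have [_ [_ [x [y]]]] := two_step; rewrite [br x y]thinmx0 eqxx.
split; [|split].
(* Case (1) is treated as the boundary value problem for x0 = 0 with B = 0. *)
- move=> J0 x00 t t0; rewrite x00 in c0.
  exact: (central_degenerate_no_conjugate_pt Gsym Gunit two_step nondeg nab_LC Jf_J z0_center dc geo c0 t0 J0).
- move=> J0 _ t t0; split.
    exact: (degenerate_conjugate_pt Gsym Gunit two_step nondeg nab_LC Jf_J z0_center x0_vpart dc geo c0 t0 J0).
  move=> _ d.
  exact: (degenerate_multiplicity Gsym Gunit two_step nondeg nab_LC Jf_J z0_center x0_vpart dc geo c0 t0 J0).
- move=> _ x00 lams lams_uniq lamsP; rewrite x00 in c0; split.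
    exact: (central_conjugate_pt Gsym Gunit two_step nondeg nab_LC Jf_J z0_center dc geo c0 lamsP).
  move=> lk k lk_lams k0 d.
  exact: (central_multiplicity Gsym Gunit two_step nondeg nab_LC Jf_J z0_center dc geo c0 lams_uniq lamsP lk_lams k0).
Qed.
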